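(* The finite simple groups $PSU(3,3)$ and $PSL(2,13)$ satisfy $|nacent(PSU(3,3))| = |nacent(PSL(2,13))| = 92$, but $PSU(3,3)\not\cong PSL(2,13)$. Consequently, it is not true that any two finite simple groups $G$ and $H$ with $|nacent(G)|=|nacent(H)|$ are isomorphic, even when $|nacent(G)|=|nacent(H)|\geq 2$.
   Context: For a group $G$ and $x\in G$, $C_G(x)=\{g\in G\mid gx=xg\}$ is the centralizer of $x$ in $G$. $cent(G)=\{C_G(x)\mid x\in G\}$ denotes the set of all centralizers of elements of $G$ (so $G=C_G(1)\in cent(G)$), and $nacent(G)$ denotes the set of all non-abelian subgroups belonging to $cent(G)$. $PSU(3,3)$ denotes the projective special unitary group of degree 3 over the finite field of order 3, i.e. the quotient by scalars of the group of determinant-one isometries of a nondegenerate Hermitian form on $\mathbb{F}_9^3$ (in the convention where the matrix entries lie in $\mathbb{F}_{3^2}$). $PSL(2,13)$ is the projective special linear group of degree 2 over the field of 13 elements. *)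

(* Defs.v *)
From mathcomp Require Import all_boot all_order all_fingroup all_algebra.
From mathcomp Require Import all_solvable.

Set Implicit Arguments.
Unset Strict Implicit.
Unset Printing Implicit Defensive.

Import GRing.Theory.
Local Open Scope group_scope.

Definition cent (gT : finGroupType) (G : {set gT}) : {set {set gT}} :=
  [set 'C_G[x] | x in G].

Definition nacent (gT : finGroupType) (G : {set gT}) : {set {set gT}} :=
  [set C in cent G | ~~ abelian C].

Section LinearGroups.

(* 'GL_n[F] consists of matrices of size n.-1.+1, so n is meant to be positive *)
Variables (n : nat) (F : finFieldType).

Definition SL : {set {'GL_n[F]}} := [set g | (\det (GLval g) == 1)%R].

Fact SL_group_set : group_set SL.
Proof.
apply/group_setP; split=> [|x y]; first by rewrite inE GL_1E det1.
by rewrite !inE GL_MxE det_mulmx => /eqP-> /eqP->; rewrite mulr1.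
Qed.
Canonical SL_group := Group SL_group_set.

Definition scalars : {set {'GL_n[F]}} := [set g | is_scalar_mx (GLval g)].

Fact scalars_group_set : group_set scalars.
Proof.
apply/group_setP; split=> [|x y].
  by rewrite inE GL_1E; apply/is_scalar_mxP; exists 1%R.
rewrite !inE GL_MxE => /is_scalar_mxP[a ->] /is_scalar_mxP[b ->].
by rewrite -scalar_mxM scalar_mx_is_scalar.
Qed.
Canonical scalars_group := Group scalars_group_set.

Definition PSL := SL / (SL :&: scalars).

Variables (theta : {rmorphism F -> F}).
Variable f : {hermitian 'rV[F]_n.-1.+1 for false & theta}%R.

(* matrices act on row vectors on the right; this is isometry f f (mulmxr g) *)
Definition isometries : {set {'GL_n[F]}} :=
  [set g | [forall u, forall v, f (u *m GLval g)%R (v *m GLval g)%R == f u v]].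

Fact isometries_group_set : group_set isometries.
Proof.
apply/group_setP; split=> [|x y].
  by rewrite inE; apply/'forall_forallP=> u v; rewrite GL_1E !mulmx1.
rewrite !inE => /'forall_'forall_eqP fx /'forall_'forall_eqP fy.
by apply/'forall_'forall_eqP=> u v; rewrite GL_MxE !mulmxA fy fx.
Qed.
Canonical isometries_group := Group isometries_group_set.

Definition SU := SL :&: isometries.
Canonical SU_group := Eval hnf in [group of SU].

Definition PSU := SU / (SU :&: scalars).

End LinearGroups.

(* Main.v *)
From HB Require Import structures.
Require Import Defs.
From mathcomp Require Import all_boot all_order all_fingroup all_algebra.
From mathcomp Require Import all_solvable all_field.
From mathcomp Require Import ring zify.

Set Implicit Arguments.
Unset Strict Implicit.
Unset Printing Implicit Defensive.

Import GRing.Theory.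

(** If a non-trivial element g of SU(3, 3) or PSL(2, 13) has a non-abelian
    centralizer, then g is of a very special shape, and its centralizer is
    determined by simple linear data that can be counted.

    In PSL(2, F), centralizing the class of x means commuting with x up to
    sign.  If the trace of x is not zero, the sign is always + and the
    centralizer is abelian, since a non-scalar 2 x 2 matrix commutes only with
    polynomials in itself ([comm_mx2P]).  If the trace is zero, there are also
    elements anticommuting with x and the centralizer is not abelian; moreover
    it determines x up to sign ([tr0_sub_C]).  There are q (q + 1) matrices of
    trace 0 and determinant 1 when -1 is a square, hence 13 * 14 / 2 = 91
    proper non-abelian centralizers when q = 13.

    In SU(3, 3), a matrix with a cyclic vector has an abelian centralizer, and
    a 3 x 3 matrix without cyclic vector differs from a scalar matrix by a
    matrix of rank at most 1 ([no_cyclic_vector]).  For an isometry the latter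
    has the form v |-> c f(v, u) u ([isometry_rank1]): the element is a
    transvection or a homology with centre the point <u>, and its centralizer
    consists of the elements scaling u by a factor of norm 1 ([cent_quasi]).
    All points of the projective plane of order 9 occur, with non-abelian and
    pairwise distinct centralizers ([fix_point_nabelian], [fix_point_sub]), so
    there are 728 / 8 = 91 of them.  In both cases the group itself, the
    centralizer of 1, is the ninety-second.

    Simplicity comes from a decomposition G = B u B w B with B the solvable
    stabilizer of a point: B is then maximal, so that a normal subgroup N not
    contained in B satisfies N B = G, whence G / N is solvable; as G is
    perfect, N = G ([bruhat_simple]).  Finally PSU(3, 3) has elements of order
    4 and PSL(2, 13) has none, because 2 is not a square modulo 13
    ([SUm_order4], [PSL2_no_order4]). *)

Local Open Scope group_scope.

(** * Simplicity from a Bruhat decomposition *)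

Lemma bruhat_gen (gT : finGroupType) (G B H : {group gT}) w :
    G \subset B :|: B * (w *: B) -> B \subset H -> w \in H ->
  G \subset H.
Proof.
move=> sG sBH Hw; apply: (subset_trans sG); rewrite subUset sBH /=.
apply/subsetP=> _ /mulsgP[b _ Bb /lcosetP[c Bc ->] ->].
by rewrite !groupM // (subsetP sBH).
Qed.

(** A proper normal subgroup contained in B lies in the core of B, hence in Z.
    One not contained in B meets B w B, hence generates G together with B, and
    G / N is a quotient of B: it is both perfect and solvable. *)
Lemma bruhat_simple (gT : finGroupType) (G B Z : {group gT}) w :
    B \subset G -> w \in G -> G \subset B :|: B * (w *: B) ->
    solvable B -> G \subset G^`(1) -> Z <| G -> Z \proper G ->
    (forall g, (forall x, x \in G -> g ^ x \in B) -> g \in Z) ->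
  simple (G / Z).
Proof.
move=> sBG Gw sG solB perfG nZG pZG coreB.
rewrite quotient_simple //; apply/maxgroupP; split.
  by rewrite pZG normal_norm.
move=> N /andP[pNG nNG] sZN; apply/eqP; rewrite eqEsubset sZN andbT.
have [sNB | /subsetPn[g Ng nBg]] := boolP (N \subset B).
  apply/subsetP=> g Ng; apply: coreB => x Gx.
  by rewrite (subsetP sNB) // memJ_norm // (subsetP nNG).
(* g lies in B w B, so it generates w together with B *)
have GNB : G \subset N <*> B.
  have NBw : w \in N <*> B.
    have Gg : g \in G by rewrite (subsetP (proper_sub pNG)).
    have := subsetP sG _ Gg; rewrite inE (negPf nBg) /=.
    case/mulsgP=> b c Bb /lcosetP[d Bd ->] def_g.
    have -> : w = b^-1 * g * d^-1 by rewrite def_g !mulgA mulVg mul1g mulgK.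
    have [sN sB] := joing_sub (erefl (N <*> B)).
    by rewrite !groupM ?groupV ?(subsetP sN g) ?(subsetP sB).
  by apply: bruhat_gen sG _ NBw; rewrite joing_subr.
have defNB : N <*> B = N * B.
  by rewrite norm_joinEr // (subset_trans sBG).
have solGN : solvable (G / N).
  apply: solvableS (quotient_sol N solB).
  by rewrite /= -(quotientMidl N B) quotientS // -defNB.
case: (eqVneq (G / N) 1) => [/trivgP|ntGN].
  rewrite quotient_sub1 // => sGN.
  by case/andP: pNG; rewrite sGN.
have := sol_der1_proper solGN (subxx _) ntGN.
by rewrite properE -quotient_der // (quotientS _ perfG) andbF.
Qed.

(** * Counting non-abelian centralizers *)

(** An isomorphism carries the centralizer of x to that of its image. *)
Lemma card_nacent_isog (gT rT : finGroupType) (G : {group gT})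
    (H : {group rT}) :
  G \isog H -> #|nacent G| = #|nacent H|.
Proof.
case/isogP=> f injf <-.
have sub_nac C : C \in nacent G -> C \subset G.
  by rewrite inE => /andP[/imsetP[x Gx ->] _]; apply: subsetIl.
suff -> : nacent (f @* G) = [set f @* C | C : {set gT} in nacent G].
  rewrite card_in_imset // => C D nC nD; apply: (injm_morphim_inj injf).
    exact: sub_nac.
  exact: sub_nac.
apply/setP=> C; apply/idP/imsetP=> [|[D nD ->]].
  rewrite inE => /andP[/imsetP[y /morphimP[x Gx _ ->] ->]].
  rewrite -injm_subcent1 // injm_abelian ?subsetIl // => nab.
  exists 'C_G[x] => //; rewrite inE nab andbT.
  by apply/imsetP; exists x.
move: (nD); rewrite !inE => /andP[/imsetP[x Gx defD]].
rewrite injm_abelian ?sub_nac // => ->; rewrite andbT.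
by apply/imsetP; exists (f x); rewrite ?mem_morphim // defD injm_subcent1.
Qed.

Lemma simple_center1 (gT : finGroupType) (G : {group gT}) :
  simple G -> ~~ abelian G -> 'Z(G) = 1.
Proof.
case/simpleP=> _ simG nabG; case: (simG _ (center_normal G)) => // defZ.
by case/negP: nabG; rewrite -defZ center_abelian.
Qed.

(** In a non-abelian simple group only 1 has G as centralizer, so that the
    members of [nacent G] other than G are the values of D on T, each taken k
    times. *)
Lemma card_nacent_simple (gT : finGroupType) (G : {group gT}) (I : finType)
    (T : {set I}) (D : I -> {set gT}) k :
    simple G -> ~~ abelian G ->
    (forall i, i \in T -> exists2 x, x \in G^# & D i = 'C_G[x]) ->
    (forall i, i \in T -> ~~ abelian (D i)) ->
    (forall x, x \in G^# -> ~~ abelian 'C_G[x] ->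
       exists2 i, i \in T & 'C_G[x] = D i) ->
    (forall i, i \in T -> #|[set j in T | D j == D i]| = k) ->
  (#|nacent G|.-1 * k)%N = #|T|.
Proof.
move=> simG nabG centD nabD Dcent fibD.
have defC x : x \in G -> ('C_G[x] == G :> {set gT}) = (x == 1).
  move=> Gx; apply/eqP/eqP=> [CG | ->]; last first.
    by rewrite cent11T setIT.
  apply/set1gP; rewrite -(simple_center1 simG nabG).
  by rewrite inE Gx /= -sub_cent1 -CG subsetIr.
have nacG : nacent G = (G : {set gT}) |: D @: T.
  apply/setP=> C; rewrite !inE; apply/andP/orP.
    case=> /imsetP[x Gx ->] nab.
    have [x1|ntx] := eqVneq x 1; first by left; rewrite defC // x1.
    right; have [|i Ti ->] := Dcent x _ nab; first by rewrite !inE ntx.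
    exact: imset_f.
  case=> [/eqP->|/imsetP[i Ti ->]].
    split=> //; apply/imsetP; exists 1 => //.
    by rewrite cent11T setIT.
  split; last exact: nabD.
  have [x /setD1P[_ Gx] ->] := centD i Ti.
  exact: imset_f.
have nDG : (G : {set gT}) \notin D @: T.
  apply/imsetP=> [[i Ti defG]]; have [x /setD1P[ntx Gx]] := centD i Ti.
  by move/eqP; rewrite -defG eq_sym defC // (negPf ntx).
rewrite nacG cardsU1 nDG /= -sum1_card (partition_big_imset D) /=.
rewrite -[LHS]sum_nat_const; apply: eq_bigr => C /imsetP[i Ti ->].
by rewrite sum1dep_card fibD.
Qed.

(** * Explicit matrices as elements of linear groups *)

Lemma commg_eq (gT : finGroupType) (x y z : gT) : x * y = y * x * z -> [~ x, y] = z.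
Proof. by rewrite commgC => /mulgI. Qed.

Lemma conjg_eq (gT : finGroupType) (x y z : gT) : x * y = y * z -> x ^ y = z.
Proof. by rewrite conjgC => /mulgI. Qed.

(** A realization of a group gT as the group of all invertible matrices.  The
    matrix groups below are defined with respect to such a realization, so that
    a change of basis is just another realization of the same group (see
    [conj_model]). *)
Record GL_model n (F : finFieldType) (gT : finGroupType) := GLModel {
  glmx :> gT -> 'M[F]_n.-1.+1;
  mkgl : 'M[F]_n.-1.+1 -> gT;
  glmx_inj : injective glmx;
  glmx1 : glmx 1 = 1%:M%R;
  glmxM : forall x y, glmx (x * y) = (glmx x *m glmx y)%R;
  glmx_unit : forall x, glmx x \in unitmx;
  mkglK : forall A, A \in unitmx -> glmx (mkgl A) = A
}.

Lemma GL_modelP n (F : finFieldType) : GL_model n F {'GL_n[F]}.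
Proof.
exists (@GLval n F) (insubd (1%g : {'GL_n[F]})).
- exact: val_inj.
- exact: GL_1E.
- exact: GL_MxE.
- exact: GL_unitmx.
by move=> A uA; rewrite -[LHS]/(val (insubd _ A)) insubdK.
Defined.

Section Model.

Variables (n : nat) (F : finFieldType) (gT : finGroupType).
Variable m : GL_model n F gT.

Definition SLm : {set gT} := [set g | \det (m g) == 1]%R.
Definition scalm : {set gT} := [set g | is_scalar_mx (m g)].

Fact SLm_group_set : group_set SLm.
Proof.
apply/group_setP; split=> [|x y]; first by rewrite inE glmx1 det1.
by rewrite !inE glmxM det_mulmx => /eqP-> /eqP->; rewrite mulr1.
Qed.
Canonical SLm_group := Group SLm_group_set.

Fact scalm_group_set : group_set scalm.
Proof.
apply/group_setP; split=> [|x y].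
  by rewrite inE glmx1 scalar_mx_is_scalar.
rewrite !inE glmxM => /is_scalar_mxP[a ->] /is_scalar_mxP[b ->].
by rewrite -scalar_mxM scalar_mx_is_scalar.
Qed.
Canonical scalm_group := Group scalm_group_set.

Lemma scalm_central : scalm \subset 'C([set: gT]).
Proof.
apply/subsetP=> z; rewrite inE => /is_scalar_mxP[a za].
by apply/centP=> g _; apply: (@glmx_inj _ _ _ m); rewrite !glmxM za scalar_mxC.
Qed.

Lemma scalm_normal (G : {group gT}) : G :&: scalm <| G.
Proof.
apply: sub_center_normal; rewrite setIS //.
by apply: subset_trans scalm_central _; rewrite centS ?subsetT.
Qed.

End Model.

Section Matrix2.

Local Open Scope ring_scope.

Variable F : comNzRingType.

Definition mx2 (a b c d : F) : 'M[F]_2 :=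
  \matrix_(i, j) (nth [::] [:: [:: a; b]; [:: c; d]] i)`_j.

Arguments mx2 (a b c d)%_R.

Lemma mx2_eta (A : 'M[F]_2) : exists a b c d, A = mx2 a b c d.
Proof.
exists (A 0 0)%R, (A 0 1)%R, (A 1 0)%R, (A 1 1)%R.
by apply/matrixP=> [[[|[|//]] ?]] [[|[|//]] ?]; rewrite mxE; congr (A _ _); apply: val_inj.
Qed.

Lemma mx2_inj a b c d a' b' c' d' :
  mx2 a b c d = mx2 a' b' c' d' -> [/\ a = a', b = b', c = c' & d = d'].
Proof.
move/matrixP=> eqA; split.
- by have := eqA 0 0; rewrite !mxE.
- by have := eqA 0 1; rewrite !mxE.
- by have := eqA 1 0; rewrite !mxE.
by have := eqA 1 1; rewrite !mxE.
Qed.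

Lemma mul_mx2 a b c d a' b' c' d' :
  (mx2 a b c d *m mx2 a' b' c' d' =
     mx2 (a * a' + b * c') (a * b' + b * d')
         (c * a' + d * c') (c * b' + d * d'))%R.
Proof.
by apply/matrixP=> [[[|[|//]] ?]] [[|[|//]] ?];
  rewrite !mxE !big_ord_recl big_ord0 !mxE /= addr0.
Qed.

Lemma det_mx2 a b c d : (\det (mx2 a b c d) = a * d - b * c)%R.
Proof.
rewrite (expand_det_row _ ord0) !big_ord_recl big_ord0 /cofactor !det_mx11.
rewrite !mxE /=; ring.
Qed.

Lemma scalar_mx2 a : (a%:M = mx2 a 0 0 a)%R.
Proof. by apply/matrixP=> [[[|[|//]] ?]] [[|[|//]] ?]; rewrite !mxE. Qed.

Lemma tr_mx2 a b c d : (\tr (mx2 a b c d) = a + d)%R.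
Proof. by rewrite /mxtrace !big_ord_recl big_ord0 !mxE /= addr0. Qed.

Lemma opp_mx2 a b c d : (- mx2 a b c d = mx2 (- a) (- b) (- c) (- d))%R.
Proof. by apply/matrixP=> [[[|[|//]] ?]] [[|[|//]] ?]; rewrite !mxE. Qed.

End Matrix2.

(** * The simplicity of PSL(2, F) *)

Section SL2.

Variables (F : finFieldType) (gT : finGroupType) (m : GL_model 2 F gT).
Implicit Types a b c d : F.
Local Notation G := (SLm_group m).

Definition sl2 a b c d : gT := mkgl m (mx2 a b c d).
Arguments sl2 (a b c d)%_R.

Lemma sl2K a b c d : (a * d - b * c = 1)%R ->
  m (sl2 a b c d) = mx2 a b c d.
Proof. by move=> det1; rewrite mkglK // unitmxE det_mx2 det1 unitr1. Qed.

Lemma mem_sl2 a b c d : (a * d - b * c = 1)%R -> sl2 a b c d \in G.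
Proof. by move=> det1; rewrite inE sl2K // det_mx2 det1. Qed.

Lemma sl2P x : x \in G ->
  exists a b c d, (a * d - b * c = 1)%R /\ x = sl2 a b c d.
Proof.
rewrite inE => /eqP detx; have [a [b [c [d defx]]]] := mx2_eta (m x).
exists a, b, c, d; rewrite -det_mx2 -defx; split=> //.
by apply: (@glmx_inj _ _ _ m); rewrite sl2K // -det_mx2 -defx.
Qed.

Lemma sl2M a b c d a' b' c' d' :
    (a * d - b * c = 1)%R -> (a' * d' - b' * c' = 1)%R ->
  sl2 a b c d * sl2 a' b' c' d' =
  sl2 (a * a' + b * c') (a * b' + b * d') (c * a' + d * c') (c * b' + d * d').
Proof.
move=> det1 det1'; apply: (@glmx_inj _ _ _ m); rewrite glmxM !sl2K ?mul_mx2 //.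
transitivity ((a * d - b * c) * (a' * d' - b' * c'))%R; first by ring.
by rewrite det1 det1' mulr1.
Qed.

Lemma mem_scalars_sl2 a b c d : (a * d - b * c = 1)%R ->
  (sl2 a b c d \in scalm m) = [&& b == 0, c == 0 & a == d]%R.
Proof.
move=> det1; rewrite inE sl2K //; apply/is_scalar_mxP/and3P.
  by case=> z; rewrite scalar_mx2 => /mx2_inj[-> -> -> ->].
by case=> /eqP-> /eqP-> /eqP->; exists d; rewrite scalar_mx2.
Qed.

(** The stabilizer of the line spanned by the second basis (row) vector. *)
Definition borel2 := [set g in G | m g 1%R 0%R == 0%R].

Lemma mem_borel2 a b c d : (a * d - b * c = 1)%R ->
  (sl2 a b c d \in borel2) = (c == 0%R).
Proof. by move=> det1; rewrite inE mem_sl2 // sl2K // mxE. Qed.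

Lemma borel2P x : x \in borel2 ->
  exists a b, (a != 0)%R /\ x = sl2 a b 0 a^-1.
Proof.
move=> Bx; have Gx : x \in G by move: Bx; rewrite inE => /andP[].
have [a [b [c [d [det1 defx]]]]] := sl2P Gx.
move: Bx; rewrite defx mem_borel2 // => /eqP c0.
have ad1 : (a * d = 1)%R by rewrite -det1 c0 mulr0 subr0.
have nza : (a != 0)%R by apply: contra_eq_neq ad1 => ->; rewrite mul0r eq_sym oner_eq0.
by exists a, b; rewrite nza c0 -[d in LHS](mulKf nza) ad1 mulr1.
Qed.

Fact borel2_group_set : group_set borel2.
Proof.
apply/group_setP; split=> [|x y].
  by rewrite inE group1 glmx1 mxE eqxx.
move=> /borel2P[a [b [nza ->]]] /borel2P[c [d [nzc ->]]].
rewrite sl2M ?mulr0 ?subr0 ?mulfV // mem_borel2; last by field; apply/andP.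
by rewrite mul0r add0r eqxx.
Qed.
Canonical borel2_group := Group borel2_group_set.

Local Notation w := (sl2 0 1 (-1) 0).
Let Gw : w \in G. Proof. by apply: mem_sl2; ring. Qed.

(** If the lower left entry c is not 0, then the row operation subtracting
    a / c times the second row from the first brings x to w times a triangular
    matrix. *)
Lemma bruhat_SL2 : G \subset borel2 :|: borel2 * (w *: borel2).
Proof.
apply/subsetP=> x Gx; have [a [b [c [d [det1 ->]]]]] := sl2P Gx.
rewrite inE mem_borel2 //; have [//|nzc /=] := eqVneq c 0%R.
have -> : sl2 a b c d = sl2 1 (a / c)%R 0 1 * (w * sl2 (- c) (- d) 0 (- c^-1)).
  have -> : w * sl2 (- c) (- d) 0 (- c^-1) = sl2 0 (- c^-1) c d.
    by rewrite sl2M; [congr sl2 | ring | ]; field.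
  rewrite sl2M; [congr sl2 | ring | by field]; try by field.
  by apply: (mulfI nzc); rewrite -[(c * b)%R](addKr 1%R) -{2}det1; field.
rewrite mem_mulg ?mem_lcoset ?mulKg ?mem_borel2 //; first by ring.
by field.
Qed.

Local Notation u x := (sl2 1 x%R 0 1).
Let det_u x : (1 * 1 - x * 0 = 1 :> F)%R. Proof. by ring. Qed.
Let uM x y : u x * u y = u (x + y)%R.
Proof. by rewrite sl2M //; congr sl2; ring. Qed.

(** Commutators of triangular matrices are unitriangular, and unitriangular
    2 x 2 matrices commute. *)
Lemma borel2_sol : solvable borel2_group.
Proof.
have der1 z : z \in borel2_group^`(1) -> exists x, z = u x.
  have gU : group_set [set u x | x : F].
    apply/group_setP; split=> [|_ _ /imsetP[x _ ->] /imsetP[y _ ->]].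
      apply/imsetP; exists 0%R => //; apply: (@glmx_inj _ _ _ m).
      by rewrite glmx1 sl2K // scalar_mx2.
    by apply/imsetP; exists (x + y)%R; rewrite ?uM.
  suff sU : borel2^`(1) \subset Group gU.
    by move/(subsetP sU)/imsetP=> [x _ ->]; exists x.
  rewrite gen_subG; apply/subsetP=> _ /imset2P[x y Bx By ->].
  case/borel2P: By => c [d [nzc ->]]; case/borel2P: Bx => a [b [nza ->]].
  apply/imsetP; exists (d / c + b / (a * c ^+ 2) - b / a - d / (a ^+ 2 * c))%R => //.
  apply: commg_eq; rewrite !sl2M; try by [ring | field; rewrite ?nza ?nzc].
  congr sl2; field; rewrite ?nza ?nzc //.
apply/derivedP; exists 2; apply/trivgP; rewrite gen_subG.
apply/subsetP=> _ /imset2P[x y Bx By ->].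
case/der1: By => b ->; case/der1: Bx => a ->.
by apply/set1gP/eqP/commgP; rewrite /commute !uM addrC.
Qed.

(** The polynomial X ^ 3 - X has at most three roots. *)
Lemma ex_sq_neq1 : 3 < #|F| -> exists2 t : F, (t != 0)%R & (t ^+ 2 != 1)%R.
Proof.
move=> F_gt3; have /subsetPn[t _] : ~~ (F \subset [:: 0; 1; -1]%R).
  apply: contraL F_gt3 => /subset_leq_card sF; rewrite -leqNgt.
  exact: leq_trans sF (card_size _).
rewrite !inE !negb_or => /and3P[nz t1 tN1]; exists t => //.
by rewrite sqrf_eq1 negb_or t1.
Qed.

(** A unitriangular matrix is a commutator of a diagonal one with another
    unitriangular one as soon as some t satisfies t ^ 2 != 1.  Products of upper
    and lower unitriangular matrices then give w and all diagonal matrices. *)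
Lemma SL2_perfect : 3 < #|F| -> G \subset G^`(1).
Proof.
case/ex_sq_neq1=> t nzt nt1.
have G'u x : u x \in G^`(1).
  (* conjugation by diag(t, 1/t) multiplies the off-diagonal entry by t ^- 2 *)
  pose y := (x / (1 - t ^- 2))%R.
  have nz1t : (1 - t ^- 2 != 0)%R.
    by rewrite subr_eq0 eq_sym invr_eq1.
  have -> : u x = [~ sl2 t 0 0 t^-1, u y].
    symmetry; apply: commg_eq; rewrite !sl2M; try by [ring | field].
    congr sl2; try ring.
    by rewrite -[x in RHS](divfK nz1t) -/y; field.
  by rewrite mem_commg ?mem_sl2 ?mulr0 ?subr0 ?mulfV ?mulr1.
have G'l x : sl2 1 0 x 1 \in G^`(1).
  have <- : u (- x)%R ^ w = sl2 1 0 x 1.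
    by apply: conjg_eq; rewrite !sl2M; try ring; congr sl2; ring.
  by rewrite memJ_norm // (subsetP (der_norm 1 _)).
have G'hw a : (a != 0)%R -> sl2 a 0 0 a^-1 * w \in G^`(1).
  move=> nza; have -> : sl2 a 0 0 a^-1 * w = u a * (sl2 1 0 (- a^-1) 1 * u a).
    by rewrite !sl2M; try by [ring | field]; congr sl2; field.
  by rewrite !groupM ?G'u ?G'l.
have G'w : w \in G^`(1).
  have := G'hw 1%R (oner_neq0 F); rewrite invr1 sl2M; try by [ring].
  by rewrite !(mul0r, mul1r, mulr0, addr0, add0r).
apply: (bruhat_gen bruhat_SL2 _ G'w).
apply/subsetP=> _ /borel2P[a [b [nza ->]]].
have -> : sl2 a b 0 a^-1 = sl2 a 0 0 a^-1 * u (b / a)%R.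
  by rewrite sl2M; try by [ring | field]; congr sl2; field.
by rewrite groupM ?G'u // -(groupMr _ G'w) G'hw.
Qed.

Lemma simple_PSLm2 : 3 < #|F| -> simple (SLm m / (SLm m :&: scalm m)).
Proof.
move=> F_gt3; apply: (@bruhat_simple _ G borel2_group _ w) => //.
- by apply/subsetP=> x; rewrite inE => /andP[].
- exact: bruhat_SL2.
- exact: borel2_sol.
- exact: SL2_perfect.
- exact: scalm_normal.
- rewrite properE subsetIl; apply/subsetPn; exists w => //.
  by rewrite inE Gw mem_scalars_sl2 ?oner_eq0 //; ring.
move=> g coreg; have /borel2P[a [b [nza defg]]]: g \in borel2.
  by rewrite -(conjg1 g) coreg ?group1.
have detg : (a * a^-1 - b * 0 = 1)%R by field.
(* a matrix that stays triangular under w is diagonal, and a diagonal matrix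
   that stays triangular under a lower unitriangular one is scalar *)
have gw : g ^ w = sl2 a^-1 0 (- b) a.
  by apply: conjg_eq; rewrite defg !sl2M; try by [ring | field]; congr sl2; ring.
have := coreg w Gw; rewrite gw mem_borel2; last by field.
rewrite oppr_eq0 => /eqP b0; rewrite b0 in defg detg.
pose l := sl2 1 0 1 1; have Gl : l \in G by apply: mem_sl2; ring.
have gl : g ^ l = sl2 a 0 (a^-1 - a) a^-1.
  by apply: conjg_eq; rewrite defg !sl2M; try by [ring | field]; congr sl2; ring.
have := coreg l Gl; rewrite gl mem_borel2; last by field.
rewrite subr_eq0 => /eqP aV.
by rewrite defg inE mem_sl2 // mem_scalars_sl2 //= aV !eqxx.
Qed.

End SL2.
Arguments sl2 {F gT} m (a b c d)%_R.

Lemma simple_PSL2 (F : finFieldType) : 3 < #|F| -> simple (PSL 2 F).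
Proof. exact: (simple_PSLm2 (GL_modelP 2 F)). Qed.

(** * Centralizers in PSL(2, F) *)

Section Centralizer2.

Variable F : fieldType.
Local Open Scope ring_scope.

(** The equation A B = B A says that the vectors (b, c, a - d) formed from the
    entries of A and of B are proportional, and that of A is not 0. *)
Lemma comm_mx2P (A B : 'M[F]_2) : ~~ is_scalar_mx A -> A *m B = B *m A ->
  exists u v, B = u%:M + v *: A.
Proof.
have [a [b [c [d ->]]]] := mx2_eta A; have [p [q [r [s ->]]]] := mx2_eta B.
rewrite !mul_mx2 => nsA /mx2_inj[e1 e2 e3 _].
have {}e1 : b * r = q * c by apply: (addrI (a * p)); rewrite e1; ring.
have {}e2 : b * s = p * b + q * d - a * q by rewrite -e2; ring.
have {}e3 : c * s = c * p + d * r - r * a by rewrite e3; ring.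
suff [u [v []]] : exists u v, [/\ p = u + v * a, q = v * b, r = v * c & s = u + v * d].
  move=> -> -> -> ->; exists u, v; rewrite scalar_mx2.
  by apply/matrixP=> [[[|[|//]] ?]] [[|[|//]] ?]; rewrite !mxE //= add0r.
have [b0 | nzb] := eqVneq b 0; last first.
  exists (p - q / b * a), (q / b); split; first by field.
  - by field.
  - by apply: (mulfI nzb); rewrite e1; field.
  by apply: (mulfI nzb); rewrite e2; field.
have [c0 | nzc] := eqVneq c 0; last first.
  exists (p - r / c * a), (r / c); split; first by field.
  - by apply: (mulfI nzc); transitivity (b * r); [rewrite e1; ring | field].
  - by field.
  by apply: (mulfI nzc); rewrite e3; field.
have nad : a - d != 0.
  apply: contra nsA; rewrite subr_eq0 => /eqP->; rewrite b0 c0.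
  by apply/is_scalar_mxP; exists d; rewrite scalar_mx2.
exists (p - (p - s) / (a - d) * a), ((p - s) / (a - d)); split; first by field.
- rewrite b0 mulr0; apply: (mulfI nad); rewrite mulr0.
  by transitivity (p * b - b * s); [rewrite e2; ring | rewrite b0; ring].
- rewrite c0 mulr0; apply: (mulfI nad); rewrite mulr0.
  by transitivity (c * p - c * s); [rewrite e3; ring | rewrite c0; ring].
by field.
Qed.

End Centralizer2.

Section PSL2.

Variables (F : finFieldType) (gT : finGroupType) (m : GL_model 2 F gT).
Local Notation G := (SLm_group m).
Local Notation Z := (G :&: scalm m).
Local Notation sl2 := (sl2 m).

(** Two classes modulo {1, -1} commute when their representatives commute up to
    sign. *)
Lemma coset_commute x y : x \in G -> y \in G ->
  reflect ((m x *m m y = m y *m m x)%R \/ (m x *m m y = - (m y *m m x))%R)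
          (coset Z y \in 'C[coset Z x]).
Proof.
move=> Gx Gy; have nZG := subsetP (normal_norm (scalm_normal m G)).
(* the scalar matrices of determinant 1 are 1 and -1 *)
have eqZ : (coset Z y \in 'C[coset Z x]) = ([~ x, y] \in Z).
  rewrite cent1C; apply/cent1P/idP=> [cxy | Zxy].
    by apply: coset_idr; rewrite ?nZG ?groupR // morphR ?nZG //; apply/eqP/commgP.
  by apply/commgP/eqP; rewrite -morphR ?nZG //; apply: coset_id.
rewrite eqZ; apply: (iffP idP) => [|cxy].
  have := congr1 m (commgC x y).
  rewrite glmxM (glmxM _ (y * x)) (glmxM _ y) => def_xy.
  case/setIP=> Gz; rewrite inE => /is_scalar_mxP[c zc].
  move: Gz; rewrite inE zc det_scalar sqrf_eq1 => /orP[] /eqP c1.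
    by left; rewrite def_xy zc c1 mulmx1.
  by right; rewrite def_xy zc c1 mul_mx_scalar scaleN1r.
case: cxy => cxy.
  suff /commgP/eqP-> : commute x y by rewrite group1.
  by apply: (@glmx_inj _ _ _ m); rewrite !glmxM.
have det1 : (-1 * -1 - 0 * 0 = 1 :> F)%R by ring.
have ->: [~ x, y] = sl2 (-1) 0 0 (-1).
  apply: commg_eq; apply: (@glmx_inj _ _ _ m); rewrite !glmxM sl2K //.
  by rewrite -scalar_mx2 mul_mx_scalar scaleN1r.
by rewrite inE mem_sl2 // mem_scalars_sl2 // !eqxx.
Qed.

Hypothesis two_nz : (2%:R != 0 :> F)%R.

(** The element y conjugates x to - x, and trace is invariant. *)
Lemma anticomm_tr0 x y : (m x *m m y = - (m y *m m x))%R -> (\tr (m x) = 0)%R.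
Proof.
move=> cxy; have : (\tr (m x) = - \tr (m x))%R.
  have e : (m y *m m y^-1%g = 1%:M)%R by rewrite -glmxM mulgV glmx1.
  have e' : (m y^-1%g *m m y = 1%:M)%R by rewrite -glmxM mulVg glmx1.
  rewrite -{1}[m x]mulmx1 -e mulmxA cxy mulNmx raddfN /=.
  by rewrite mxtrace_mulC !mulmxA e' mul1mx.
by move/eqP; rewrite -subr_eq0 opprK -mulr2n -mulr_natr mulf_eq0 (negPf two_nz) orbF => /eqP.
Qed.

Lemma eq_opp_mx2 (A : 'M[F]_2) : A = (- A)%R -> A = 0%R.
Proof.
move/eqP; rewrite -subr_eq0 opprK -mulr2n -scaler_nat scaler_eq0 (negPf two_nz).
by move/eqP.
Qed.

Lemma glmx_neq0 x : m x != 0%R.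
Proof.
by apply: contraTneq (glmx_unit m x) => ->; rewrite unitmxE det0 unitr0.
Qed.

Definition tr0 : {set gT} := [set x in G | \tr (m x) == 0]%R.

Lemma tr0P x : x \in tr0 ->
  exists a b c, (a * - a - b * c = 1)%R /\ x = sl2 a b c (- a).
Proof.
rewrite inE => /andP[/sl2P[a [b [c [d [det1 ->]]]]]].
rewrite sl2K // tr_mx2 addrC addr_eq0 => /eqP da.
by exists a, b, c; rewrite -da.
Qed.

Lemma mem_tr0 a b c : (a * - a - b * c = 1)%R -> sl2 a b c (- a) \in tr0.
Proof. by move=> det1; rewrite inE mem_sl2 // sl2K // tr_mx2 subrr eqxx. Qed.

Lemma tr0_nscal x : x \in tr0 -> ~~ is_scalar_mx (m x).
Proof.
case/tr0P=> a [b [c [det1 ->]]]; have := mem_scalars_sl2 m det1; rewrite inE => ->.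
apply/and3P=> [[/eqP b0 _]]; rewrite -subr_eq0 opprK -mulr2n -mulr_natr.
rewrite mulf_eq0 (negPf two_nz) orbF => /eqP a0.
by move/eqP: det1; rewrite a0 b0 !mul0r subr0 eq_sym oner_eq0.
Qed.

(** Since x ^ 2 = -1, the determinant of u + v x is u ^ 2 + v ^ 2. *)
Lemma tr0_torus x u v : x \in tr0 -> (u ^+ 2 + v ^+ 2 = 1)%R ->
  exists2 y, y \in G & m y = (u%:M + v *: m x)%R.
Proof.
case/tr0P=> a [b [c [det1 ->]]] uv1.
have detu : ((u + v * a) * (u - v * a) - (v * b) * (v * c) = 1)%R.
  rewrite -[RHS]uv1 -[(v ^+ 2)%R]mulr1 -det1; ring.
exists (sl2 (u + v * a) (v * b) (v * c) (u - v * a)); first exact: mem_sl2.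
rewrite !sl2K // scalar_mx2.
by apply/matrixP=> [[[|[|//]] ?]] [[|[|//]] ?]; rewrite !mxE //= ?add0r ?mulrN.
Qed.

Variable i : F.
Hypothesis i2 : (i ^+ 2 = -1)%R.

(** The quadratic form det restricted to the trace 0 matrices orthogonal to x
    represents 1: with i at hand, the solutions can be written down. *)
Lemma tr0_anticomm x : x \in tr0 ->
  exists2 z, z \in G & (m z *m m x = - (m x *m m z))%R.
Proof.
case/tr0P=> a [b [c [det1 ->]]].
(* two trace 0 matrices anticommute iff the trace of their product is 0 *)
suff [p [q [r [detz]]]] : exists p q r, (p * - p - q * r = 1)%R
    /\ (2%:R * (p * a) + q * c + b * r = 0)%R.
  move=> ortho; exists (sl2 p q r (- p)); first exact: mem_sl2.
  rewrite !sl2K // !mul_mx2 opp_mx2; congr mx2.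
  - by rewrite -[LHS]subr0 -ortho; ring.
  - by ring.
  - by ring.
  by rewrite -[LHS]subr0 -ortho; ring.
have [b0 | nzb] := eqVneq b 0%R; last first.
  exists i, 0%R, (- (2%:R * i * a / b))%R; split; last by field.
  by rewrite -[RHS]opprK -i2; ring.
have [c0 | nzc] := eqVneq c 0%R; last first.
  exists i, (- (2%:R * i * a / c))%R, 0%R; split; last by field.
  by rewrite -[RHS]opprK -i2; ring.
by exists 0%R, 1%R, (-1)%R; rewrite b0 c0; split; ring.
Qed.

Variables u v : F.
Hypotheses (uv1 : (u ^+ 2 + v ^+ 2 = 1)%R) (nzu : u != 0%R) (nzv : v != 0%R).

Local Notation C x := 'C_(G / Z)[coset Z x].

Lemma mem_C x y : x \in G -> y \in G ->
  reflect ((m x *m m y = m y *m m x)%R \/ (m x *m m y = - (m y *m m x))%R)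
          (coset Z y \in C x).
Proof.
move=> Gx Gy; rewrite in_setI mem_quotient //=; exact: coset_commute.
Qed.

(** A torus element u + v x with u and v non-zero centralizes x, and so does an
    element z anticommuting with x; but z maps u + v x to u - v x, which is not
    u + v x up to sign. *)
Lemma tr0_nabelian x : x \in tr0 -> ~~ abelian (C x).
Proof.
move=> Tx; have Gx : x \in G by case/setIdP: Tx.
have [y Gy def_y] := tr0_torus Tx uv1.
have [z Gz czx] := tr0_anticomm Tx.
apply/negP=> /centsP abC.
have : coset Z z \in 'C[coset Z y].
  apply/cent1P; apply: abC; apply/mem_C => //.
    by right; rewrite czx opprK.
  by left; rewrite def_y mulmxDl mulmxDr scalar_mxC -scalemxAl -scalemxAr.
have xz_nz : ((m x *m m z)%R != 0%R) by rewrite -glmxM glmx_neq0.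
case/coset_commute=> //; rewrite def_y mulmxDl mulmxDr -scalemxAl -scalemxAr czx.
  rewrite scalar_mxC => /addrI/(scalerI nzv) xzN.
  by case/eqP: xz_nz; apply: eq_opp_mx2.
rewrite scalar_mxC scalerN opprB [RHS]addrC => /addIr.
rewrite mul_scalar_mx -scalerN => /(scalerI nzu) zN.
by case/eqP: (glmx_neq0 z); apply: eq_opp_mx2.
Qed.

(** The element u + v x of the torus through x has non-zero trace, so that
    for an element y commuting with it up to sign the sign is +: then y
    commutes with x, and y is a linear combination of 1 and x. *)
Lemma tr0_sub_C x y : x \in tr0 -> y \in tr0 -> C x \subset C y ->
  y = x \/ y = x * sl2 (-1) 0 0 (-1).
Proof.
move=> Tx Ty /subsetP sC; have [t Gt def_t] := tr0_torus Tx uv1.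
have [Gx /eqP trx] := setIdP Tx; have [Gy /eqP try] := setIdP Ty.
have trt : (\tr (m t) != 0)%R.
  rewrite def_t raddfD /= linearZ /= trx mulr0 addr0 mxtrace_scalar.
  by rewrite -mulr_natr mulf_neq0.
have cty : (m t *m m y = m y *m m t)%R.
  have /mem_C[] // : coset Z t \in C y.
    apply: sC; apply/mem_C => //; left.
    by rewrite def_t mulmxDl mulmxDr scalar_mxC -scalemxAl -scalemxAr.
  move=> cyt; case/eqP: trt; apply: (@anticomm_tr0 _ y).
  by rewrite cyt opprK.
have cxy : (m x *m m y = m y *m m x)%R.
  move: cty; rewrite def_t mulmxDl mulmxDr scalar_mxC -scalemxAl -scalemxAr.
  by move/addrI/(scalerI nzv).
have [a [b def_y]] := comm_mx2P (tr0_nscal Tx) cxy.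
have a0 : a = 0%R.
  move: try; rewrite def_y raddfD /= linearZ /= trx mulr0 addr0 mxtrace_scalar.
  by rewrite -mulr_natr => /eqP; rewrite mulf_eq0 (negPf two_nz) orbF => /eqP.
rewrite a0 raddf0 add0r in def_y.
have : (\det (m y) == 1)%R by rewrite inE in Gy.
rewrite def_y detZ; have -> : (\det (m x) = 1)%R by move: Gx; rewrite inE => /eqP.
rewrite mulr1 sqrf_eq1 => /orP[] /eqP b1; [left | right].
  by apply: (@glmx_inj _ _ _ m); rewrite def_y b1 scale1r.
apply: (@glmx_inj _ _ _ m); rewrite glmxM def_y b1 sl2K; last by ring.
by rewrite -scalar_mx2 mul_mx_scalar.
Qed.

Lemma card_C_fibre x : x \in tr0 -> #|[set y in tr0 | C y == C x]| = 2.
Proof.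
move=> Tx; have [Gx _] := setIdP Tx; pose n := sl2 (-1) 0 0 (-1).
have detn : (-1 * -1 - 0 * 0 = 1 :> F)%R by ring.
have Zn : n \in Z by rewrite inE mem_sl2 // mem_scalars_sl2 // !eqxx.
have mxn : m (x * n) = (- m x)%R.
  by rewrite glmxM sl2K // -scalar_mx2 mul_mx_scalar scaleN1r.
have -> : [set y in tr0 | C y == C x] = [set x; x * n].
  apply/setP=> y; apply/setIdP/set2P=> [[Ty /eqP eqC] | [-> // | ->]].
    by apply: tr0_sub_C Tx Ty _; rewrite eqC.
  split; last by rewrite coset_kerr.
  rewrite inE groupM //=; last by case/setIP: Zn.
  by rewrite mxn raddfN oppr_eq0; case/setIdP: Tx.
rewrite cards2; case: eqP => // xn; case/eqP: (glmx_neq0 x).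
by apply: eq_opp_mx2; rewrite -mxn -xn.
Qed.

Lemma card_tr0 : #|tr0| = (#|F| * #|F|.+1)%N.
Proof.
(* for b != 0 the third entry is determined by a and b; for b = 0 it is free,
   and a is one of the two square roots of -1 *)
pose S := [set t : F * F * F | t.1.1 * - t.1.1 - t.1.2 * t.2 == 1]%R.
have -> : tr0 = [set sl2 t.1.1 t.1.2 t.2 (- t.1.1) | t in S].
  apply/setP=> x; apply/idP/imsetP=> [/tr0P[a [b [c [det1 ->]]]] | [[[a b] c]]].
    by exists (a, b, c); rewrite // inE det1.
  by rewrite inE /= => /eqP det1 ->; apply: mem_tr0.
rewrite card_in_imset; last first.
  move=> [[a b] c] [[a' b'] c']; rewrite !inE /= => /eqP det1 /eqP det1'.
  by move/(congr1 m); rewrite !sl2K // => /mx2_inj[-> -> -> _].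
pose f a b := #|[set c : F | a * - a - b * c == 1]%R|.
have -> : #|S| = (\sum_a \sum_b f a b)%N.
  rewrite pair_bigA /=; under [RHS]eq_bigr do rewrite /f -sum1dep_card.
  by rewrite pair_big_dep /= -sum1dep_card.
have fnz a b : (b != 0)%R -> f a b = 1%N.
  move=> nzb; rewrite /f -(cards1 ((a * - a - 1) / b)%R); congr #|pred_of_set _|.
  apply/setP=> c; rewrite !inE; apply/eqP/eqP=> [e | ->]; last by field.
  by rewrite -[X in ((_ - X) / b)%R]e; field.
have f0 a : f a 0%R = ((a \in [set i; - i]%R) * #|F|)%N.
  rewrite /f !inE -eqf_sqr i2; case: eqP => a2; rewrite ?mul1n ?mul0n.
    rewrite -cardsT; congr #|pred_of_set _|; apply/setP=> c.
    by rewrite !inE mul0r subr0 mulrN -expr2 a2 opprK eqxx.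
  apply: eq_card0 => c; rewrite !inE mul0r subr0 mulrN -expr2 eqr_oppLR.
  exact/eqP.
transitivity (\sum_(a : F) ((a \in [set i; - i]%R) * #|F| + #|F|.-1))%N.
  apply: eq_bigr => a _; rewrite (bigD1 0%R) //= f0; congr (_ + _)%N.
  rewrite (eq_bigr (fun _ => 1%N)); last by move=> b /fnz.
  by rewrite sum1_card -(cardC1 (0%R : F)).
rewrite big_split /= -big_distrl /= sum_nat_const.
have -> : (\sum_(a : F) (a \in [set i; - i]%R) = 2)%N.
  rewrite -big_mkcond /= sum1_card cards2; case: eqP => // iN.
  move/eqP: iN; rewrite -subr_eq0 opprK -mulr2n -mulr_natr mulf_eq0 (negPf two_nz).
  rewrite orbF => /eqP i0; move/eqP: i2.
  by rewrite i0 expr0n eq_sym oppr_eq0 oner_eq0.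
have : 0 < #|F| by apply/card_gt0P; exists 0%R.
by case: #|F| => // k _; rewrite (mulnC 2) -mulnDr.
Qed.

Lemma card_nacent_PSLm2 : simple (G / Z) ->
  (#|nacent (G / Z)|.-1 * 2 = #|F| * #|F|.+1)%N.
Proof.
move=> simGZ; rewrite -card_tr0.
have GT x : x \in tr0 -> x \in G by case/setIdP.
have tr0_i : sl2 i 0 0 (- i) \in tr0.
  by apply: mem_tr0; rewrite -[RHS]opprK -i2; ring.
have nabGZ : ~~ abelian (G / Z).
  by apply: contra (tr0_nabelian tr0_i); apply: abelianS; apply: subsetIl.
apply: (card_nacent_simple simGZ nabGZ (D := fun x => C x)) => [x Tx||x|] //.
- exists (coset Z x) => //; rewrite !inE mem_quotient ?GT // andbT.
  have nZx : x \in 'N(Z) by rewrite (subsetP (normal_norm (scalm_normal m G))) ?GT.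
  apply: contra (tr0_nscal Tx) => /eqP/(coset_idr nZx).
  by rewrite inE => /andP[_]; rewrite inE.
- exact: tr0_nabelian.
- case/setD1P=> ntx /morphimP[g nZg Gg defx]; rewrite {}defx /= in ntx * => nabC.
  exists g => //; rewrite inE Gg /=; apply: contraR nabC => trg.
  have nsg : ~~ is_scalar_mx (m g).
    apply: contra ntx => sg; apply/eqP; apply: coset_id.
    by rewrite inE Gg inE.
  have Cg z : z \in C g -> exists h a b,
     [/\ h \in G, z = coset Z h & m h = a%:M + b *: m g]%R.
    move=> Cz; have /morphimP[h _ Gh defz] : z \in G / Z by case/setIP: Cz.
    rewrite defz in Cz *; case/mem_C: Cz => // cgh.
      by have [a [b def_h]] := comm_mx2P nsg cgh; exists h, a, b.
    by case/eqP: trg; apply: anticomm_tr0 cgh.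
  apply/centsP=> _ /Cg[h [a [b [Gh -> def_h]]]] _ /Cg[k [c [d [Gk -> def_k]]]].
  apply/cent1P; apply/coset_commute => //; left.
  rewrite def_h def_k !(mulmxDl, mulmxDr) -!scalemxAl -!scalemxAr.
  rewrite !(mul_scalar_mx, mul_mx_scalar) !scalerA !scale_scalar_mx addrACA.
  by rewrite [(c * a)%R]mulrC [(d * b)%R]mulrC; congr (_ + (_ *: _ + _))%R; rewrite mulrC.
exact: card_C_fibre.
Qed.

(** Let x be the class of g, of trace t.  The trace of g ^ 2 is t ^ 2 - 2, which
    is not 0; so if g ^ 4 = (g ^ 2) ^ 2 is scalar, then g ^ 2 is scalar. *)
Lemma quotient_no_order4 x : (forall t : F, t ^+ 2 != 2%:R)%R ->
  x \in G / Z -> x ^+ 4 = 1 -> x ^+ 2 = 1.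
Proof.
move=> nsq2 /morphimP[g nZg Gg ->]; rewrite -!morphX // => /coset_idr.
rewrite groupX // => /(_ isT) Zg4.
apply: coset_id; rewrite inE groupX //=.
have Gy : g ^+ 2 \in G by rewrite groupX.
have trg2 : (\tr (m (g ^+ 2)%g) != 0)%R.
  have [a [b [c [d [det1 ->]]]]] := sl2P Gg.
  rewrite expgS expg1 sl2M // sl2K; last first.
    by transitivity ((a * d - b * c) ^+ 2)%R; [ring | rewrite det1 expr1n].
  rewrite tr_mx2; apply: contraNneq (nsq2 (a + d)%R) => trg0.
  rewrite -subr_eq0 -trg0; apply/eqP.
  by transitivity ((a + d) ^+ 2 - 2%:R * (a * d - b * c))%R; [rewrite det1 mulr1 | ring].
have : g ^+ 2 * g ^+ 2 \in scalm m.
  by rewrite -expgD; case/setIP: Zg4.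
(* by Cayley-Hamilton, if y has non-zero trace and y ^ 2 is scalar, so is y *)
have [p [q [r [s [det1 def_y]]]]] := sl2P Gy; move: trg2; rewrite def_y.
rewrite sl2K // tr_mx2 => nz; rewrite sl2M // !mem_scalars_sl2 //; last first.
  by transitivity ((p * s - q * r) ^+ 2)%R; [ring | rewrite det1 expr1n].
have -> : (p * q + q * s = (p + s) * q)%R by ring.
have -> : (r * p + s * r = (p + s) * r)%R by ring.
rewrite -[(_ * _ + _ == _)%R]subr_eq0.
have -> : (p * p + q * r - (r * q + s * s) = (p + s) * (p - s))%R by ring.
by rewrite !mulf_eq0 (negPf nz) /= subr_eq0.
Qed.

End PSL2.

Lemma card_nacent_PSL2 (F : finFieldType) (i u v : F) :
    3 < #|F| -> (2%:R != 0 :> F)%R -> (i ^+ 2 = -1)%R ->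
    (u ^+ 2 + v ^+ 2 = 1)%R -> u != 0%R -> v != 0%R ->
  (#|nacent (PSL 2 F)|.-1 * 2 = #|F| * #|F|.+1)%N.
Proof.
move=> F_gt3 two_nz i2 uv1 nzu nzv.
exact: (card_nacent_PSLm2 two_nz i2 uv1 nzu nzv (simple_PSLm2 (GL_modelP 2 F) F_gt3)).
Qed.

Lemma PSL2_no_order4 (F : finFieldType) x : (forall t : F, t ^+ 2 != 2%:R)%R ->
  x \in PSL 2 F -> x ^+ 4 = 1 -> x ^+ 2 = 1.
Proof. exact: (@quotient_no_order4 F _ (GL_modelP 2 F)). Qed.

Local Close Scope group_scope.
Local Open Scope ring_scope.

(** * Matrices without a cyclic vector *)

Section Cyclic.

Variable F : fieldType.

(** If v is a cyclic vector of A, a matrix B commuting with A is determined by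
    v B = v p(A): it is p(A). *)
Lemma cyclic_comm n (A B C : 'M[F]_n.+1) (v : 'rV_n.+1) :
    (forall x : 'rV_n.+1, exists p : {poly F}, x = v *m horner_mx A p) ->
    comm_mx A B -> comm_mx A C -> comm_mx B C.
Proof.
move=> cycv cAB cAC.
have cB p : comm_mx (horner_mx A p) B by apply/comm_mx_sym/comm_mx_horner/comm_mx_sym.
have cC p : comm_mx (horner_mx A p) C by apply/comm_mx_sym/comm_mx_horner/comm_mx_sym.
have [p vB] := cycv (v *m B); have [q vC] := cycv (v *m C).
have vBC : v *m (B *m C) = v *m (C *m B).
  rewrite !mulmxA vB vC -!mulmxA cC cB !mulmxA vB vC -!mulmxA.
  by congr (v *m _); rewrite -![_ *m _]/(_ * _) -!rmorphM mulrC.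
apply/row_matrixP=> i; rewrite !rowE; have [r ->] := cycv (delta_mx 0 i).
have rBC (D E : 'M_n.+1) : comm_mx (horner_mx A r) D ->
    comm_mx (horner_mx A r) E ->
    v *m horner_mx A r *m (D *m E) = v *m (D *m E) *m horner_mx A r.
  by move=> cD cE; rewrite -!mulmxA (mulmxA _ D) cD -!mulmxA cE.
by rewrite !rBC // vBC.
Qed.


Lemma non_row_full3 (a b c : 'rV[F]_3) : ~~ row_full (col_mx a (col_mx b c)) ->
  exists x y z, [/\ x *: a + y *: b + z *: c = 0 & [|| x != 0, y != 0 | z != 0]].
Proof.
set A := col_mx _ _; rewrite /row_full -[_ == _]/(row_free A) -kermx_eq0.
case/rowV0Pn=> w /sub_kermxP wA nzw.
have [x [y [z w_def]]] : exists x y z, w = row_mx x%:M (row_mx y%:M z%:M).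
  rewrite -[w]hsubmxK -[rsubmx w]hsubmxK [lsubmx w]mx11_scalar.
  rewrite [lsubmx (rsubmx w)]mx11_scalar [rsubmx (rsubmx w)]mx11_scalar.
  by do 3!eexists.
exists x, y, z; split.
  by move: wA; rewrite w_def !mul_row_col !mul_scalar_mx addrA.
apply: contraNT nzw; rewrite !negb_or !negbK => /and3P[/eqP x0 /eqP y0 /eqP z0].
by rewrite w_def x0 y0 z0 !raddf0 !row_mx0.
Qed.

Definition cyclic_vector (A : 'M[F]_3) (v : 'rV_3) :=
  row_full (col_mx v (col_mx (v *m A) (v *m A *m A))).

Lemma cyclic_vector_comm (A B C : 'M[F]_3) v :
  cyclic_vector A v -> comm_mx A B -> comm_mx A C -> comm_mx B C.
Proof.
move=> cycv; apply: (cyclic_comm (v := v)) => x.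
have /submxP[w ->] := submx_full x cycv.
rewrite -[w]hsubmxK -[rsubmx w]hsubmxK [lsubmx w]mx11_scalar.
rewrite [lsubmx (rsubmx w)]mx11_scalar [rsubmx (rsubmx w)]mx11_scalar.
move: (_ 0 0) (_ 0 0) (_ 0 0) => c b a.
exists (a%:P + b *: 'X + c *: 'X^2).
rewrite !mul_row_col !mul_scalar_mx !rmorphD /= horner_mx_C !linearZ /= rmorphXn /=.
rewrite horner_mx_X !mulmxDr mul_mx_scalar -!scalemxAr expr2 addrA.
by rewrite -mulmxA.
Qed.

Lemma non_eigenvector n (A : 'M[F]_n.+1) : ~~ is_scalar_mx A ->
  exists v : 'rV_n.+1, ~~ (v *m A <= v)%MS.
Proof.
pose eigb (v : 'rV[F]_n.+1) := (v *m A <= v)%MS.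
pose e i : 'rV[F]_n.+1 := delta_mx 0 i.
have [/forallP eigA | /forallPn[i]] :=
    boolP [forall i, eigb (e i) && eigb (e 0 + e i)]; last first.
  by rewrite negb_and => /orP[]; [exists (e i) | exists (e 0 + e i)].
case/negP; have eig v : eigb v -> exists a, v *m A = a *: v.
  by move=> /sub_rVP[a ->]; exists a.
have [a0 e0] : exists a, e 0 *m A = a *: e 0 by apply: eig; case/andP: (eigA 0).
apply/is_scalar_mxP; exists a0.
apply/row_matrixP=> i; rewrite !rowE mul_mx_scalar -/(e i).
have [->//|nzi] := eqVneq i 0.
have /andP[/eig[b eb] /eig[c ec]] := eigA i.
rewrite mulmxDl e0 eb in ec; rewrite eb.
have /(congr1 (fun B : 'rV_n.+1 => B 0 0)) := ec.
have /(congr1 (fun B : 'rV_n.+1 => B 0 i)) := ec.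
rewrite !mxE !eqxx /= ![0 == i]eq_sym (negPf nzi) !(mulr0, mulr1, addr0, add0r).
by move=> -> ->.
Qed.

(** Unless A is scalar, some v together with v A spans a plane W, which is
    A-invariant since v is not cyclic.  Let A induce multiplication by u on the
    quotient by W, and put T = A - u.  The absence of cyclic vectors forces
    every vector in the image of T to be an eigenvector of T.  If T had rank 2,
    its image would be W, which contains v, and v would be an eigenvector of
    A. *)
Lemma no_cyclic_vector (A : 'M[F]_3) :
    2%:R != 0 :> F -> (forall v, ~~ cyclic_vector A v) ->
  exists u, (\rank (A - u%:M)%R <= 1)%N.
Proof.
move=> two_nz nocyc.
have [/is_scalar_mxP[u ->] | /non_eigenvector[v nev]] := boolP (is_scalar_mx A).
  by exists u; rewrite subrr mxrank0.
(* the plane W spanned by v and v A is A-invariant *)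
pose W := col_mx v (v *m A).
have nzv : v != 0 by apply: contra nev => /eqP->; rewrite mul0mx sub0mx.
have rW : \rank W = 2.
  apply/eqP; rewrite eqn_leq rank_leq_row ltnNge; apply: contra nev => rW1.
  have sv : (v <= W)%MS by rewrite -addsmxE addsmxSl.
  have [rv eW] := mxrank_leqif_sup sv.
  have : (W <= v)%MS by rewrite -eW rank_rV nzv in rv *; rewrite eqn_leq rv.
  by rewrite -addsmxE addsmx_sub => /andP[].
have vAAW : (v *m A *m A <= W)%MS.
  pose X := col_mx v (col_mx (v *m A) (v *m A *m A)).
  have XE : (X :=: v + (v *m A + v *m A *m A))%MS.
    apply: eqmx_trans (eqmx_sym (addsmxE _ _)) _.
    exact: adds_eqmx (eqmx_refl _) (eqmx_sym (addsmxE _ _)).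
  have sWX : (W <= X)%MS.
    rewrite XE -addsmxE addsmx_sub addsmxSl /=.
    exact: submx_trans (addsmxSl _ _) (addsmxSr _ _).
  have := mxrank_leqif_sup sWX; rewrite rW => -[rX eX].
  have : (X <= W)%MS.
    rewrite -eX eqn_leq rX -ltnS ltn_neqAle rank_leq_col andbT; exact: nocyc v.
  by rewrite XE !addsmx_sub => /and3P[].
(* c is a column with kernel W; it is an eigenvector of A on the other side,
   so that T = A - u maps everything into W *)
pose K := kermx W^T; have rK : \rank K = 1%N by rewrite mxrank_ker mxrank_tr rW.
have KP (d : 'cV_3) : (d^T <= K)%MS = (W *m d == 0).
  by rewrite sub_kermx -trmx_mul trmx_eq0.
pose c := (nz_row K)^T.
have nzc : c != 0 by rewrite -trmx_eq0 trmxK nz_row_eq0 -mxrank_eq0 rK.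
have WcP (d : 'cV_3) : W *m d = 0 -> exists u, d = u *: c.
  move=> Wd; have /sub_rVP[u def_d] : (d^T <= nz_row K)%MS; last first.
    by exists u; rewrite -[d]trmxK def_d linearZ.
  have sK : (nz_row K <= K)%MS := nz_row_sub K.
  have := mxrank_leqif_sup sK; rewrite rank_rV nz_row_eq0 -mxrank_eq0 rK => -[_].
  by rewrite eqxx => /esym; apply: submx_trans; rewrite KP Wd.
have Wc : W *m c = 0 by apply/eqP; rewrite -KP trmxK nz_row_sub.
have [u def_u] : exists u, A *m c = u *: c.
  apply: WcP; have /submxP[D WA] : (W *m A <= W)%MS.
    by rewrite mul_col_mx -addsmxE addsmx_sub vAAW -addsmxE addsmxSr.
  by rewrite mulmxA WA -mulmxA Wc mulmx0.
pose T := A - u%:M.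
have Tc : T *m c = 0 by rewrite mulmxBl def_u mul_scalar_mx subrr.
(* apply c to a linear relation between y, y A, y A ^ 2: outside W, the
   coefficient of y in terms of y, y T, y T ^ 2 vanishes *)
have eigT1 (y : 'rV_3) : y *m c != 0 -> exists b, y *m T *m T = b *: (y *m T).
  move=> yc; have [x [s [r [lin nz]]]] := non_row_full3 (nocyc y).
  have defA : A = T + u%:M by rewrite subrK.
  have {}lin : (x + s * u + r * u ^+ 2) *: y + (s + 2%:R * u * r) *: (y *m T)
                 + r *: (y *m T *m T) = 0.
    rewrite -[RHS]lin defA !mulmxDr !mulmxDl !mul_mx_scalar -!scalemxAl.
    move: (y *m T) (y *m T *m T) => a b.
    by apply/rowP=> k; rewrite !mxE; ring.
  have x0 : x + s * u + r * u ^+ 2 = 0.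
    have /eqP := congr1 (mulmx^~ c) lin; rewrite mul0mx !mulmxDl -!scalemxAl -!mulmxA Tc.
    by rewrite !mulmx0 !scaler0 !addr0 scaler_eq0 (negPf yc) orbF => /eqP.
  move: lin; rewrite x0 scale0r add0r; have [r0 | nzr] := eqVneq r 0.
    rewrite r0 mulr0 scale0r !addr0 => /eqP; rewrite scaler_eq0 => /orP[/eqP s0 | /eqP yT0].
      by move: nz; rewrite r0 s0 eqxx -x0 s0 r0 !mul0r !addr0 eqxx.
    by exists 0; rewrite yT0 mul0mx scaler0.
  move/eqP; rewrite addrC addr_eq0 => /eqP def_yTT.
  exists (r^-1 * - (s + 2%:R * u * r)).
  by rewrite -scalerA scaleNr -def_yTT scalerA mulVf // scale1r.
(* inside W, compare z + y and z - y for some z outside W *)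
have eigT (y : 'rV_3) : exists b, y *m T *m T = b *: (y *m T).
  have [yc | ] := eqVneq (y *m c) 0; last exact: eigT1.
  have [z zc] : exists z : 'rV_3, z *m c != 0.
    suff [k zk] : exists k : 'I_3, (delta_mx 0 k : 'rV_3) *m c != 0 by eexists; exact: zk.
    apply/existsP; apply: contraNT nzc => /existsPn zc; apply/eqP/row_matrixP=> k.
    by rewrite rowE row0; apply/eqP; rewrite -[_ == _]negbK zc.
  have [b eb] := eigT1 z zc.
  have [b1 e1] : exists b, (z + y) *m T *m T = b *: ((z + y) *m T).
    by apply: eigT1; rewrite mulmxDl yc addr0.
  have [b2 e2] : exists b, (z - y) *m T *m T = b *: ((z - y) *m T).
    by apply: eigT1; rewrite mulmxBl yc subr0.
  move: e1 e2 eb; rewrite !(mulmxDl, mulmxBl, mulNmx).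
  set a := z *m T; set d := y *m T => e1 e2 eb.
  have [eb12 | nb12] := eqVneq b1 b2.
    exists b1; apply: (scalerI two_nz).
    transitivity (a *m T + d *m T - (a *m T - d *m T)); last first.
      by rewrite e1 e2 eb12; apply/rowP=> k; rewrite !mxE; ring.
    by apply/rowP=> k; rewrite !mxE; ring.
  rewrite -subr_eq0 in nb12; pose k := (2%:R * b - b1 - b2) / (b1 - b2).
  have dka : d = k *: a.
    apply: (scalerI nb12); rewrite scalerA [_ * k]mulrC divfK //.
    transitivity (b1 *: (a + d) + b2 *: (a - d) - (b1 + b2) *: a).
      by apply/rowP=> l; rewrite !mxE; ring.
    rewrite -e1 -e2 eb; apply/rowP=> l; rewrite !mxE; ring.
  by exists b; rewrite dka -scalemxAl eb !scalerA mulrC.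
exists u; rewrite leqNgt; apply/negP=> rT.
(* rank at least 2 would make W the image of T, and v an eigenvector of T *)
have /submxP[y def_v] : (v <= T)%MS.
  have sT : (T <= kermx c)%MS by rewrite sub_kermx Tc.
  have := mxrank_leqif_sup sT; rewrite mxrank_ker /c mxrank_tr rank_rV.
  rewrite nz_row_eq0 -mxrank_eq0 rK => -[rT2]; rewrite eqn_leq rT2 rT => /esym.
  apply: submx_trans; rewrite sub_kermx.
  by move/eqP: Wc; rewrite mul_col_mx col_mx_eq0 => /andP[].
have [b eb] := eigT y.
case/negP: nev; apply/sub_rVP; exists (b + u).
by rewrite -[A](subrK u%:M) -/T mulmxDr mul_mx_scalar scalerDl {1}def_v eb -def_v.
Qed.

End Cyclic.

(** * The field of order 9 *)

Section F9.

Variable F : finFieldType.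
Hypothesis cardF : #|F| = 9%N.

Lemma F9_3 : 3%:R = 0 :> F.
Proof. by have := @card_finPcharP F 3 2 cardF isT; rewrite inE => /andP[_ /eqP]. Qed.

Lemma F9_2 : 2%:R = -1 :> F.
Proof. by apply/eqP; rewrite -addr_eq0 natr1 F9_3. Qed.

Lemma F9_2nz : 2%:R != 0 :> F.
Proof. by rewrite F9_2 oppr_eq0 oner_eq0. Qed.

Lemma F9_exp8 (a : F) : a != 0 -> a ^+ 8 = 1.
Proof.
by move=> nza; apply: (mulfI nza); rewrite mulr1 -exprS -[RHS]expf_card cardF.
Qed.

Lemma F9_exp4 (a : F) : a != 0 -> a ^+ 4 = 1 \/ a ^+ 4 = -1.
Proof.
move=> nza; have /eqP := F9_exp8 nza; rewrite (exprM a 4 2) sqrf_eq1.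
by case/orP=> /eqP; [left | right].
Qed.

(** The polynomial X ^ 4 - 1 cannot vanish at all 8 non-zero elements. *)
Lemma F9_prim : exists w : F, w ^+ 4 = -1.
Proof.
have /subsetPn[w] : ~~ ([pred x : F | x != 0] \subset [pred x | x ^+ 4 == 1]).
  apply/negP=> /subset_leq_card; rewrite cardC1 cardF /= leqNgt.
  move/negP; apply; rewrite cardE; apply: (@leq_ltn_trans 4) => //.
  apply: max_unity_roots => //; last exact: enum_uniq.
  by apply/allP=> x; rewrite mem_enum inE unity_rootE.
rewrite !inE => nzw; case: (F9_exp4 nzw) => [->|]; first by rewrite eqxx.
by exists w.
Qed.

Lemma F9_cube_fixed (s : F) : s ^+ 3 = s -> [\/ s = 0, s = 1 | s = -1].
Proof.
move/eqP; rewrite -subr_eq0; have -> : s ^+ 3 - s = s * (s - 1) * (s + 1) by ring.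
by rewrite !mulf_eq0 subr_eq0 addr_eq0 => /orP[/orP[]|] /eqP->; [constructor 1 | constructor 2 | constructor 3].
Qed.

(** Here a ^ 4 is the norm of a to the field of order 3, whose elements are the
    solutions of s ^ 3 = s. *)
Lemma F9_norm_onto (s : F) : s ^+ 3 = s -> exists a, a ^+ 4 = s.
Proof.
case/F9_cube_fixed=> ->; first by exists 0; rewrite expr0n.
  by exists 1; rewrite expr1n.
exact: F9_prim.
Qed.

End F9.

(** * Geometry of the Hermitian form *)

Section Form.

Variables (F : finFieldType) (theta : {rmorphism F -> F}).
Variable f : {hermitian 'rV[F]_3 for false & theta}.
Hypotheses (cardF : #|F| = 9%N) (thetaE : forall a, theta a = a ^+ 3).
Hypothesis f_nondeg : nondegenerate f.
Local Notation V := ('rV[F]_3).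
Implicit Types u v w z x y : V.

(** Linearity rules for f with the scaling by theta made explicit. *)
Lemma fDl u v w : f (u + v) w = f u w + f v w. Proof. exact: linearDl. Qed.
Lemma fDr u v w : f u (v + w) = f u v + f u w. Proof. exact: linearDr. Qed.
Lemma fZl a u v : f (a *: u) v = a * f u v. Proof. exact: linearZl_LR. Qed.
Lemma fZr a u v : f u (a *: v) = theta a * f u v.
Proof. exact: linearZr_LR. Qed.
Lemma fC u v : f u v = theta (f v u).
Proof. by rewrite hermC expr0 mul1r. Qed.
Lemma f0l v : f 0 v = 0. Proof. exact: linear0l. Qed.

Lemma thetaK : involutive theta.
Proof. by move=> a; rewrite !thetaE -exprM -[(3 * 3)%N]cardF expf_card. Qed.

Lemma thetaN4 a : a * theta a = a ^+ 4. Proof. by rewrite thetaE -exprS. Qed.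

Lemma f_eq0C u v : (f u v == 0) = (f v u == 0).
Proof. by rewrite fC fmorph_eq0. Qed.

Lemma fself_cube u : f u u ^+ 3 = f u u.
Proof. by rewrite -thetaE -fC. Qed.

Lemma f_inj u : (forall v, f u v = 0) -> u = 0.
Proof.
move=> fu0; apply/eqP; rewrite -memv0 -(eqP f_nondeg).
by apply/mem_orthovP=> v _; apply: fu0.
Qed.

Lemma f_neq0 u : u != 0 -> exists e, f e u = 1.
Proof.
move=> nzu; have [v fvu] : exists v, f v u != 0.
  apply/existsP; apply: contraNT nzu => /existsPn fu0; apply/eqP/f_inj => v.
  by apply/eqP; rewrite f_eq0C; have := fu0 v; rewrite negbK.
by exists ((f v u)^-1 *: v); rewrite fZl mulVf.
Qed.

(** The functional f(., v) vanishes on the kernel of f(., u), so it is a multiple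
    of it. *)
Lemma perp_colinear u v : u != 0 -> (forall z, f z u = 0 -> f z v = 0) ->
  exists a, v = a *: u.
Proof.
move=> nzu sub; have [e feu] := f_neq0 nzu.
exists (theta (f e v)); apply/eqP; rewrite -subr_eq0; apply/eqP/f_inj=> x.
apply/eqP; rewrite f_eq0C -scaleNr fDr fZr rmorphN thetaK mulNr subr_eq0.
have := sub (x - f x u *: e); rewrite -scaleNr !fDl !fZl feu mulr1 subrr => /(_ erefl).
by move/eqP; rewrite mulNr subr_eq0 mulrC.
Qed.

(** The orthogonal of u is a plane. *)
Lemma perp_not_line u v : u != 0 -> exists2 z, f z u = 0 & forall a, z != a *: v.
Proof.
move=> nzu; have [e feu] := f_neq0 nzu.
have [x nx] : exists x : V, ~~ (x <= col_mx e v)%MS.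
  have /row_subPn[i ni] : ~~ (1%:M <= col_mx e v)%MS.
    apply: contraTN (rank_leq_row (col_mx e v)) => /mxrankS.
    by rewrite mxrank1 -ltnNge.
  by exists (row i 1%:M).
exists (x - f x u *: e); first by rewrite -scaleNr !fDl !fZl feu mulr1 subrr.
move=> a; apply: contraNneq nx => /eqP; rewrite subr_eq => /eqP->.
rewrite -addsmxE addmx_sub // scalemx_sub //; first exact: addsmxSr.
exact: addsmxSl.
Qed.

(** If the plane orthogonal to u were totally isotropic, each of its vectors
    would be a multiple of u by [perp_colinear].  A pair of proportional
    non-orthogonal vectors can be changed into an independent one. *)
Lemma perp_nonorthogonal u : u != 0 ->
  exists z1 z2, [/\ f z1 u = 0, f z2 u = 0, f z1 z2 != 0 & forall a, z2 != a *: z1].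
Proof.
move=> nzu; have [z1 fz1 nz1] := perp_not_line u nzu.
have [z2 fz2 nf12] : exists2 z2, f z2 u = 0 & f z1 z2 != 0.
  suff /existsP[z2 /andP[/eqP fz2 nf12]] : [exists z2, (f z2 u == 0) && (f z1 z2 != 0)] by exists z2.
  apply: contraT => /existsPn all0; have [a def_z1] : exists a, z1 = a *: u.
    apply: perp_colinear => // z fz0; apply/eqP; rewrite f_eq0C.
    by have := all0 z; rewrite fz0 eqxx negbK.
  by have := nz1 a; rewrite def_z1 eqxx.
have [/existsP[a /eqP def_z2] | /existsPn ncol] := boolP [exists a, z2 == a *: z1]; last first.
  by exists z1, z2.
have f11 : f z1 z1 != 0.
  by apply: contraNneq nf12 => f11; rewrite def_z2 fZr f11 mulr0.
have [z3 fz3 nz3] := perp_not_line z1 nzu.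
have [f13 | nf13] := eqVneq (f z1 z3) 0; last by exists z1, z3.
exists z1, (z1 + z3); split=> //; first by rewrite fDl fz1 fz3 addr0.
  by rewrite fDr f13 addr0.
move=> b; apply: contraNneq (nz3 (b - 1)) => e13; apply/eqP.
by rewrite scalerBl scale1r -e13 addrAC subrr add0r.
Qed.

End Form.

(** * Isometries that differ from a scalar by a matrix of rank 1 *)

Section Isometry.

Variables (F : finFieldType) (theta : {rmorphism F -> F}).
Variable f : {hermitian 'rV[F]_3 for false & theta}.
Hypotheses (cardF : #|F| = 9%N) (thetaE : forall a, theta a = a ^+ 3).
Hypothesis f_nondeg : nondegenerate f.
Local Notation V := ('rV[F]_3).
Implicit Types (u v w z x y : V) (A B : 'M[F]_3).

Definition isometry_mx A := forall u v, f (u *m A) (v *m A) = f u v.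

Definition gram : 'M[F]_3 := matrix_of_form f.

Lemma gramE u v : u *m gram *m map_mx theta v^T = (f u v)%:M.
Proof.
rewrite [LHS]mx11_scalar; congr _%:M.
by have := matrix_of_formK f u v; rewrite /form_of_matrix /mxtrace big_ord1 => <-.
Qed.

Lemma gram_unit : gram \in unitmx.
Proof.
rewrite -row_free_unit; apply: inj_row_free => v vM0; apply: (f_inj f_nondeg) => w.
have := gramE v w; rewrite vM0 mul0mx => /(congr1 (fun B : 'M_1 => B 0 0)).
by rewrite !mxE.
Qed.

(** The Gram matrix of the rows of A. *)
Lemma gram_rows A i j :
  (A *m gram *m map_mx theta A^T) i j = f (row i A) (row j A).
Proof.
have := congr1 (fun B : 'M_1 => B 0 0) (gramE (row i A) (row j A)).
rewrite [X in _ = X -> _]mxE mulr1n => <-.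
by rewrite -row_mul !mxE; apply: eq_bigr => k _; rewrite !mxE.
Qed.

(** Take determinants in A M A^* = M, where M is the invertible Gram matrix of the
    form. *)
Lemma det_isometry A : isometry_mx A -> \det A * theta (\det A) = 1.
Proof.
move=> isoA; have defM : A *m gram *m map_mx theta A^T = gram.
  by apply/matrixP=> i j; rewrite gram_rows !rowE isoA mxE.
have /(congr1 determinant) := defM; rewrite !det_mulmx det_map_mx det_tr.
have : \det gram != 0 by rewrite -unitfE -unitmxE gram_unit.
by move=> nz e; apply: (mulIf nz); rewrite mul1r -[RHS]e mulrAC.
Qed.

(** The endomorphism v |-> f(v, u) u, acting on row vectors. *)
Definition rank1 u : 'M[F]_3 := gram *m map_mx theta u^T *m u.

Lemma mul_rank1 v u : v *m rank1 u = f v u *: u.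
Proof. by rewrite !mulmxA gramE mul_scalar_mx. Qed.

Lemma riesz (c : 'cV[F]_3) : exists u, c = gram *m map_mx theta u^T.
Proof.
exists (map_mx theta (invmx gram *m c)^T).
rewrite map_trmx trmxK -map_mx_comp (map_mx_id (thetaK cardF thetaE)).
by rewrite mulKVmx ?gram_unit.
Qed.

(** These are the c for which v |-> v + c f(v, u) u is an isometry: a
    transvection if u is isotropic, a homology otherwise. *)
Lemma ex_transvection_coef u : exists2 c, c != 0 &
  c + theta c + c * theta c * f u u = 0.
Proof.
have nz1 := oner_neq0 F; have := F9_3 cardF.
case: (F9_cube_fixed (fself_cube f thetaE u)) => fuu three0.
(* when u is isotropic, c is a square root of -1, an element of trace 0 *)
- have [w w4] := F9_prim cardF; exists (w ^+ 2).
    by apply: contra_eqN w4 => w0; rewrite (exprM w 2 2) (eqP w0) expr0n eq_sym oppr_eq0.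
  rewrite thetaE fuu mulr0 addr0 -exprM (exprD w 2 4) w4; ring.
- exists 1; rewrite // thetaE fuu expr1n -[RHS]three0; ring.
exists (-1); first by rewrite oppr_eq0.
rewrite thetaE fuu -[RHS]oppr0 -three0; ring.
Qed.

Lemma quasi_isometry u c : c + theta c + c * theta c * f u u = 0 ->
  isometry_mx (1%:M + c *: rank1 u).
Proof.
move=> c0 v w; rewrite !mulmxDr !mulmx1 -!scalemxAr !mul_rank1 !scalerA.
rewrite !fDl !fDr !fZl !fZr rmorphM -[theta (f w u)]fC.
rewrite -[RHS]addr0 -[0 in RHS](mulr0 (f v u * f u w)) -c0; ring.
Qed.

Lemma scale_isometry d A : d * theta d = 1 -> isometry_mx A -> isometry_mx (d *: A).
Proof.
by move=> d1 isoA v w; rewrite -!scalemxAr fZl fZr isoA mulrA d1 mul1r.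
Qed.

(** The determinant d of an isometry has norm d ^ 4 = 1, so that multiplying the
    3 x 3 matrix by d makes its determinant d ^ 3 d = 1. *)
Lemma ex_special_quasi u : u != 0 -> exists a c,
  [/\ a * theta a = 1, c != 0, isometry_mx (a%:M + c *: rank1 u)
    & \det (a%:M + c *: rank1 u) = 1].
Proof.
move=> nzu; have [c nzc c0] := ex_transvection_coef u.
pose A := 1%:M + c *: rank1 u; have isoA := quasi_isometry c0.
have d1 := det_isometry isoA; rewrite -/A in d1; set d := \det A in d1.
have defA : d *: A = d%:M + (d * c) *: rank1 u.
  by rewrite scalerDr scalerA scale_scalar_mx mulr1.
exists d, (d * c); split=> //.
- by rewrite mulf_neq0 //; apply: contra_eqN d1 => /eqP->; rewrite mul0r eq_sym oner_eq0.
- by rewrite -defA; apply: scale_isometry.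
by rewrite -defA detZ -/d -thetaE mulrC.
Qed.

Lemma rank1_mx A : (\rank A <= 1)%N -> exists c u, A = c *m u :> 'M[F]_3.
Proof.
move=> rA; exists (col_base A *m pid_mx (\rank A)), (pid_mx (\rank A) *m row_base A).
by rewrite -mulmxA (mulmxA (pid_mx _)) pid_mx_id // pid_mx_1 mul1mx mulmx_base.
Qed.

(** Write A v = a v + f(v, u') u.  On the orthogonal of u', where f is not
    identically 0, A is multiplication by a, so a has norm 1; then f(v, u) = 0
    for v orthogonal to u', that is, u is a multiple of u'. *)
Lemma isometry_rank1 A a : A != a%:M -> (\rank (A - a%:M)%R <= 1)%N ->
    isometry_mx A -> 
  exists c u, [/\ c != 0, u != 0 & A = a%:M + c *: rank1 u].
Proof.
move=> nsA /rank1_mx[c [u def_Aa]] isoA.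
have [u' def_c] := riesz c.
have def_A : A = a%:M + c *m u by rewrite -def_Aa addrC subrK.
have nzcu : c *m u != 0 by apply: contra nsA => /eqP e; rewrite def_A e addr0.
have nzu : u != 0 by apply: contraNneq nzcu => ->; rewrite mulmx0.
have nzu' : u' != 0.
  by apply: contraNneq nzcu => u0; rewrite def_c u0 trmx0 map_mx0 mulmx0 mul0mx.
have vA v : v *m A = a *: v + f v u' *: u.
  by rewrite def_A mulmxDr mul_mx_scalar def_c !mulmxA gramE mul_scalar_mx.
have [z1 [z2 [f1 f2 f12 _]]] := perp_nonorthogonal cardF thetaE f_nondeg nzu'.
have a1 : a * theta a = 1.
  have := isoA z1 z2; rewrite !vA f1 f2 !scale0r !addr0 fZl fZr mulrA => e.
  by apply: (mulIf f12); rewrite e mul1r.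
have nza : a != 0 by apply: contra_eqN a1 => /eqP->; rewrite mul0r eq_sym oner_eq0.
have [b def_u] : exists b, u = b *: u'.
  apply: (perp_colinear cardF thetaE f_nondeg nzu') => z fz.
  have [w fw] := f_neq0 f_nondeg nzu'.
  have := isoA z w; rewrite !vA fz scale0r addr0 fw scale1r fDr !fZl fZr mulrA a1 mul1r.
  by move/eqP; rewrite -subr_eq0 addrC addKr mulf_eq0 (negPf nza) => /eqP.
exists b, u'; split=> //.
  by apply: contraNneq nzu => b0; rewrite def_u b0 scale0r.
by rewrite def_A def_u def_c -scalemxAr.
Qed.

End Isometry.

(** * Centralizers in SU(3, 3) *)

Section SU3.

Variables (F : finFieldType) (theta : {rmorphism F -> F}).
Variable f : {hermitian 'rV[F]_3 for false & theta}.
Variables (gT : finGroupType) (m : GL_model 3 F gT).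
Local Notation V := ('rV[F]_3).
Implicit Types (u v w z x y : V) (g h : gT).

Definition SUm : {set gT} := SLm m :&:
  [set g | [forall u, forall v, f (u *m m g) (v *m m g) == f u v]].

Lemma SUmP g : reflect (\det (m g) = 1 /\ isometry_mx f (m g)) (g \in SUm).
Proof.
rewrite !inE; apply: (iffP andP) => [[/eqP detg /'forall_'forall_eqP] | [-> isog]] //.
by split=> //; apply/'forall_'forall_eqP.
Qed.

Fact SUm_group_set : group_set SUm.
Proof.
apply/group_setP; split=> [|g h /SUmP[detg isog] /SUmP[deth isoh]]; apply/SUmP.
  by rewrite glmx1 det1; split=> // u v; rewrite !mulmx1.
rewrite glmxM det_mulmx detg deth mulr1; split=> // u v.
by rewrite !mulmxA isoh isog.
Qed.
Canonical SUm_group := Group SUm_group_set.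

(** The elements scaling u by a factor of norm 1.  For u anisotropic this is
    the whole stabilizer of the point <u>; for u isotropic it has index 2. *)
Definition fix_point u : {set gT} :=
  [set g in SUm | [exists a, (a * theta a == 1) && (u *m m g == a *: u)]].

Lemma fix_pointP g u : reflect
  (g \in SUm /\ exists2 a, a * theta a = 1 & u *m m g = a *: u)
  (g \in fix_point u).
Proof.
apply: (iffP setIdP) => [[Gg /existsP[a /andP[/eqP a1 /eqP ug]]] | [Gg [a a1 ug]]].
  by split=> //; exists a.
by split=> //; apply/existsP; exists a; rewrite a1 ug !eqxx.
Qed.

Lemma fix_pointZ a u : a != 0 -> fix_point (a *: u) = fix_point u.
Proof.
move=> nza; apply/setP=> g; rewrite !inE; congr (_ && _).
apply: eq_existsb => b; congr (_ && _).
by rewrite -scalemxAl scalerA mulrC -scalerA (inj_eq (scalerI nza)).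
Qed.

Hypotheses (cardF : #|F| = 9%N) (thetaE : forall a, theta a = a ^+ 3).
Hypothesis f_nondeg : nondegenerate f.

(** Commuting with t means commuting with R : v |-> f(v, u) u, and an isometry g
    conjugates R to v |-> f(v, u g) u g. *)
Lemma cent_quasi t u a c : u != 0 -> c != 0 -> t \in SUm ->
  m t = a%:M + c *: rank1 f u -> 'C_SUm[t]%g = fix_point u.
Proof.
move=> nzu nzc Gt def_t; have [e feu] := f_neq0 f_nondeg nzu.
have commE g : (g \in 'C[t]%g) = (m g *m rank1 f u == rank1 f u *m m g).
  apply/cent1P/eqP=> [cgt | cgu].
    have := congr1 m cgt; rewrite !glmxM def_t mulmxDr mulmxDl scalar_mxC.
    by rewrite -scalemxAl -scalemxAr => /addrI/(scalerI nzc).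
  apply: (@glmx_inj _ _ _ m); rewrite !glmxM def_t mulmxDr mulmxDl scalar_mxC.
  by rewrite -scalemxAl -scalemxAr cgu.
apply/setP=> g; rewrite in_setI commE; apply/andP/fix_pointP=> [[Gg /eqP cgu] | [Gg [b b1 ug]]].
  split=> //; have [_ isog] := SUmP _ Gg.
  have ug : u *m m g = f (e *m m g) u *: u.
    by rewrite -mul_rank1 -mulmxA cgu mulmxA mul_rank1 feu scale1r.
  exists (f (e *m m g) u) => //.
  by have := isog e u; rewrite ug fZr feu mulrC.
split=> //; apply/eqP/row_matrixP=> i; rewrite !rowE (mulmxA _ (m g)).
rewrite (mulmxA _ (rank1 f u)) !mul_rank1.
have [_ isog] := SUmP _ Gg; rewrite -scalemxAl ug scalerA; congr (_ *: _).
by have := isog (delta_mx 0 i) u; rewrite ug fZr => <-; rewrite mulrAC [theta b * b]mulrC b1 mul1r.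
Qed.

Lemma ex_quasi u : u != 0 -> exists t a c, [/\ t \in SUm, c != 0,
  a * theta a = 1 & m t = a%:M + c *: rank1 f u].
Proof.
move=> nzu; have [a [c [a1 nzc isot dett]]] := ex_special_quasi cardF thetaE f_nondeg nzu.
have defA : m (mkgl m (a%:M + c *: rank1 f u)) = a%:M + c *: rank1 f u.
  by rewrite mkglK // unitmxE dett unitr1.
exists (mkgl m (a%:M + c *: rank1 f u)), a, c; split=> //.
by apply/SUmP; rewrite defA.
Qed.

(** An element t with centre z acts on the orthogonal of z as a scalar. *)
Lemma quasi_fix t a c u z : t \in SUm -> a * theta a = 1 -> f z u = 0 ->
  m t = a%:M + c *: rank1 f z -> t \in fix_point u.
Proof.
move=> Gt a1 fzu def_t; apply/fix_pointP; split=> //; exists a => //.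
rewrite def_t mulmxDr mul_mx_scalar -scalemxAr mul_rank1.
by have /eqP := fzu; rewrite f_eq0C => /eqP->; rewrite scale0r scaler0 addr0.
Qed.

(** For independent, non-orthogonal z1 and z2 in the orthogonal of u, the elements with
    centres z1 and z2 fix u and do not commute. *)
Lemma fix_point_nabelian u : u != 0 -> ~~ abelian (fix_point u).
Proof.
move=> nzu; have [z1 [z2 [f1 f2 f12 ncol]]] := perp_nonorthogonal cardF thetaE f_nondeg nzu.
have nz1 : z1 != 0 by apply: contraNneq f12 => ->; rewrite f0l.
have nz2 : z2 != 0 by have := ncol 0; rewrite scale0r.
have [t1 [a1 [c1 [G1 nzc1 na1 def1]]]] := ex_quasi nz1.
have [t2 [a2 [c2 [G2 nzc2 na2 def2]]]] := ex_quasi nz2.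
apply/negP=> /centsP abD.
have c12 := abD _ (quasi_fix G1 na1 f1 def1) _ (quasi_fix G2 na2 f2 def2).
have : t1 \in 'C_SUm[t2]%g by rewrite inE G1; apply/cent1P.
rewrite (cent_quasi nz2 nzc2 G2 def2) => /fix_pointP[_ [b _]].
rewrite def1 mulmxDr mul_mx_scalar -scalemxAr mul_rank1 => e.
have nzk : c1 * f z2 z1 != 0 by rewrite mulf_neq0 // f_eq0C.
have def_z1 : z1 = ((b - a1) / (c1 * f z2 z1)) *: z2.
  apply: (scalerI nzk); rewrite -scalerA !scalerA [_ * (_ / _)]mulrC divfK //.
  by rewrite scalerBl -e addrC addKr scalerA.
have nzb : (b - a1) / (c1 * f z2 z1) != 0.
  by apply: contraNneq nz1 => b0; rewrite def_z1 b0 scale0r.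
case/eqP: (ncol ((b - a1) / (c1 * f z2 z1))^-1).
by rewrite {2}def_z1 scalerA mulVf // scale1r.
Qed.

(** If z is orthogonal to u, the element with centre z fixes <u>, hence <v>; so
    v is orthogonal to z or is a multiple of it.  The second case can be avoided by
    moving z in the orthogonal of u, so that v is orthogonal to the whole
    of it. *)
Lemma fix_point_sub u v : u != 0 -> v != 0 -> fix_point u \subset fix_point v ->
  exists a, v = a *: u.
Proof.
move=> nzu nzv /subsetP sD; apply: (perp_colinear cardF thetaE f_nondeg nzu).
have alt z : f z u = 0 -> f v z = 0 \/ exists a, z = a *: v.
  move=> fzu; have [-> | nzz] := eqVneq z 0; first by right; exists 0; rewrite scale0r.
  have [t [a [c [Gt nzc na def_t]]]] := ex_quasi nzz.
  have /sD/fix_pointP[_ [b _]] := quasi_fix Gt na fzu def_t.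
  rewrite def_t mulmxDr mul_mx_scalar -scalemxAr mul_rank1 => e.
  have [|nfz] := eqVneq (f v z) 0; [by left | right].
  have nzk : c * f v z != 0 by rewrite mulf_neq0.
  exists ((b - a) / (c * f v z)); apply: (scalerI nzk).
  by rewrite -scalerA !scalerA [_ * (_ / _)]mulrC divfK // scalerBl -e addrC addKr scalerA.
move=> z fzu; apply/eqP; rewrite f_eq0C; apply: contraT => nfz.
case: (alt z fzu) => [fvz | [k def_z]]; first by rewrite fvz eqxx in nfz.
have nzk : k != 0 by apply: contraNneq nfz => k0; rewrite def_z k0 scale0r linear0r.
have fvu : f v u = 0 by move/eqP: fzu; rewrite def_z fZl mulf_eq0 (negPf nzk) => /eqP.
have [y fyu ny] := perp_not_line f_nondeg v nzu.
have fvy : f v y = 0 by case: (alt y fyu) => // [[b def_y]]; have := ny b; rewrite def_y eqxx.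
have : f (y + v) u = 0 by rewrite fDl fyu fvu addr0.
case/alt => [|[b e]].
  by rewrite fDr fvy add0r => fvv; rewrite def_z fZr fvv mulr0 eqxx in nfz.
by have := ny (b - 1); rewrite scalerBl scale1r -e addrK eqxx.
Qed.

Lemma quasi_nscal t a c u : u != 0 -> c != 0 -> 
  m t = a%:M + c *: rank1 f u -> t != 1%g.
Proof.
move=> nzu nzc def_t; apply/eqP=> t1; rewrite t1 glmx1 in def_t.
have vE v : v = a *: v + (c * f v u) *: u.
  by rewrite -[LHS]mulmx1 def_t mulmxDr mul_mx_scalar -scalemxAr mul_rank1 scalerA.
have [z fzu nz] := perp_not_line f_nondeg u nzu.
have a1 : a = 1.
  have /eqP := vE z; rewrite fzu mulr0 scale0r addr0 -subr_eq0 -[z in z - _]scale1r -scalerBl.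
  rewrite scaler_eq0 subr_eq0 => /orP[/eqP-> // | /eqP z0].
  by have := nz 0; rewrite z0 scale0r eqxx.
have [e feu] := f_neq0 f_nondeg nzu.
have /eqP := vE e; rewrite a1 feu scale1r mulr1 -subr_eq0 opprD addrA subrr sub0r oppr_eq0.
by rewrite scaler_eq0 (negPf nzc) (negPf nzu).
Qed.

(** A scalar of determinant 1 has a ^ 3 = 1, and cubing is injective. *)
Lemma SUm_scalar g a : g \in SUm -> m g = a%:M -> g = 1%g.
Proof.
move=> /SUmP[detg isog] def_g; apply: (@glmx_inj _ _ _ m); rewrite glmx1 def_g.
have a3 : theta a = 1 by rewrite thetaE -detg def_g det_scalar.
by rewrite -[a](thetaK cardF thetaE) a3 rmorph1.
Qed.

Lemma nonabelian_cent g : g \in SUm -> g != 1%g -> ~~ abelian 'C_SUm[g]%g ->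
  exists2 u, u != 0 & 'C_SUm[g]%g = fix_point u.
Proof.
move=> Gg ntg nabC.
have nocyc v : ~~ cyclic_vector (m g) v.
  apply: contra nabC => cycv; apply/centsP=> h /setIP[_ /cent1P cgh] k /setIP[_ /cent1P cgk].
  apply: (@glmx_inj _ _ _ m); rewrite !glmxM; apply: (cyclic_vector_comm cycv).
    by have /esym := congr1 m cgh; rewrite !glmxM.
  by have /esym := congr1 m cgk; rewrite !glmxM.
have [a ra] := no_cyclic_vector (F9_2nz cardF) nocyc.
have nsg : m g != a%:M by apply: contra ntg => /eqP/(SUm_scalar Gg)->.
have [_ isog] := SUmP _ Gg.
have [c [u [nzc nzu def_g]]] := isometry_rank1 cardF thetaE f_nondeg nsg ra isog.
by exists u => //; apply: cent_quasi def_g.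
Qed.

(** The 9 ^ 3 - 1 non-zero vectors give all proper non-abelian centralizers, two
    of them giving the same one exactly when they span the same point. *)
Lemma card_nacent_SUm : simple SUm -> (#|nacent SUm|.-1 * 8 = 728)%N.
Proof.
move=> simSU.
have cardT : #|[set u : V | u != 0]| = 728%N.
  by rewrite -[RHS]/((9 ^ (1 * 3)).-1)%N -{}cardF -card_mx -(cardsC1 (0 : V)); apply: eq_card => u; rewrite !inE.
have nab : ~~ abelian SUm.
  have nze : delta_mx 0 0 != 0 :> V.
    by apply/eqP=> /matrixP/(_ 0 0)/eqP; rewrite !mxE oner_eq0.
  apply: contra (fix_point_nabelian nze); apply: abelianS.
  by apply/subsetP=> g /fix_pointP[].
rewrite -cardT.
apply: (card_nacent_simple (D := fix_point) simSU nab) => [u|u|g|u].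
- rewrite inE => nzu; have [t [a [c [Gt nzc _ def_t]]]] := ex_quasi nzu.
  exists t; last by rewrite (cent_quasi nzu nzc Gt def_t).
  by apply/setD1P; rewrite (quasi_nscal nzu nzc def_t).
- by rewrite inE; apply: fix_point_nabelian.
- case/setD1P=> ntg Gg /(nonabelian_cent Gg ntg)[u nzu ->].
  by exists u; rewrite ?inE.
rewrite inE => nzu.
have -> : [set v in [set u : V | u != 0] | fix_point v == fix_point u] =
          [set a *: u | a in [set~ (0 : F)]].
  apply/setP=> v; apply/setIdP/imsetP=> [[] | [a]]; rewrite !inE.
    move=> nzv /eqP eqD; have [a def_v] : exists a, v = a *: u.
      by apply: fix_point_sub => //; rewrite eqD.
    by exists a; rewrite // !inE; apply: contraNneq nzv => a0; rewrite def_v a0 scale0r.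
  by move=> nza ->; rewrite scaler_eq0 negb_or nza nzu fix_pointZ.
rewrite card_in_imset; first by rewrite cardsC1 cardF.
by move=> a b _ _ /eqP; rewrite -subr_eq0 -scalerBl scaler_eq0 (negPf nzu) orbF subr_eq0 => /eqP.
Qed.

End SU3.

(** * The simplicity of SU(3, 3) *)

Section Matrix3.

Variable F : comNzRingType.

Definition mx3 (a b c d e f g h i : F) : 'M[F]_3 :=
  \matrix_(k, l) (nth [::] [:: [:: a; b; c]; [:: d; e; f]; [:: g; h; i]] k)`_l.

Lemma mx3_eta (A : 'M[F]_3) :
  exists a b c d e f g h i, A = mx3 a b c d e f g h i.
Proof.
pose o1 : 'I_3 := Ordinal (isT : 1 < 3)%N.
exists (A ord0 ord0), (A ord0 o1), (A ord0 ord_max),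
  (A o1 ord0), (A o1 o1), (A o1 ord_max),
  (A ord_max ord0), (A ord_max o1), (A ord_max ord_max).
by apply/matrixP=> [[[|[|[|//]]] ?]] [[|[|[|//]]] ?]; rewrite mxE;
  congr (A _ _); apply: val_inj.
Qed.

Lemma mx3_inj a b c d e f g h i a' b' c' d' e' f' g' h' i' :
    mx3 a b c d e f g h i = mx3 a' b' c' d' e' f' g' h' i' ->
  ([/\ a = a', b = b' & c = c'] * [/\ d = d', e = e' & f = f'] *
   [/\ g = g', h = h' & i = i'])%type.
Proof.
pose o1 : 'I_3 := Ordinal (isT : 1 < 3)%N.
move/matrixP=> eqA; do !split.
- by have := eqA ord0 ord0; rewrite !mxE.
- by have := eqA ord0 o1; rewrite !mxE.
- by have := eqA ord0 ord_max; rewrite !mxE.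
- by have := eqA o1 ord0; rewrite !mxE.
- by have := eqA o1 o1; rewrite !mxE.
- by have := eqA o1 ord_max; rewrite !mxE.
- by have := eqA ord_max ord0; rewrite !mxE.
- by have := eqA ord_max o1; rewrite !mxE.
by have := eqA ord_max ord_max; rewrite !mxE.
Qed.

Lemma mul_mx3 a b c d e f g h i a' b' c' d' e' f' g' h' i' :
  mx3 a b c d e f g h i *m mx3 a' b' c' d' e' f' g' h' i' =
  mx3 (a * a' + b * d' + c * g') (a * b' + b * e' + c * h') (a * c' + b * f' + c * i')
      (d * a' + e * d' + f * g') (d * b' + e * e' + f * h') (d * c' + e * f' + f * i')
      (g * a' + h * d' + i * g') (g * b' + h * e' + i * h') (g * c' + h * f' + i * i').
Proof.
by apply/matrixP=> [[[|[|[|//]]] ?]] [[|[|[|//]]] ?];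
  rewrite !mxE !big_ord_recl big_ord0 !mxE /= addr0 addrA.
Qed.

Lemma det_mx3 a b c d e f g h i : \det (mx3 a b c d e f g h i) =
  a * (e * i - f * h) - b * (d * i - f * g) + c * (d * h - e * g).
Proof.
rewrite (expand_det_row _ ord0) !big_ord_recl big_ord0 /cofactor.
rewrite !(expand_det_row _ ord0) !big_ord_recl !big_ord0 /cofactor !det_mx11.
by rewrite !mxE /=; ring.
Qed.

Lemma tr_mx3 a b c d e f g h i :
  (mx3 a b c d e f g h i)^T = mx3 a d g b e h c f i.
Proof. by apply/matrixP=> [[[|[|[|//]]] ?]] [[|[|[|//]]] ?]; rewrite !mxE. Qed.

Lemma map_mx3 (phi : F -> F) a b c d e f g h i :
  map_mx phi (mx3 a b c d e f g h i) = mx3 (phi a) (phi b) (phi c)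
    (phi d) (phi e) (phi f) (phi g) (phi h) (phi i).
Proof. by apply/matrixP=> [[[|[|[|//]]] ?]] [[|[|[|//]]] ?]; rewrite !mxE. Qed.

Lemma scalar_mx3 a : a%:M = mx3 a 0 0 0 a 0 0 0 a.
Proof. by apply/matrixP=> [[[|[|[|//]]] ?]] [[|[|[|//]]] ?]; rewrite !mxE. Qed.

End Matrix3.

Section Hyperbolic.

Variables (F : finFieldType) (theta : {rmorphism F -> F}).
Variables (gT : finGroupType) (m : GL_model 3 F gT) (G : {group gT}).
Local Notation "a ^*" := (theta a) : ring_scope.
Implicit Types (a b c d e t : F) (x y g : gT).

Definition hyperbolic : 'M[F]_3 := mx3 0 0 1 0 1 0 1 0 0.

Hypothesis thetaK : involutive theta.
Hypothesis three0 : 3%:R = 0 :> F.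
Hypothesis norm_onto : forall b, exists a, b + b^* + a * a^* = 0.
Hypothesis memG : forall g, g \in G <->
  \det (m g) = 1 /\ m g *m hyperbolic *m map_mx theta (m g)^T = hyperbolic.

Let eqm x y : m x = m y -> x = y. Proof. exact: glmx_inj. Qed.

Lemma mkgl1K A : \det A = 1 -> m (mkgl m A) = A.
Proof. by move=> detA; rewrite mkglK // unitmxE detA unitr1. Qed.

(** The determinant and the products f(r, s) of the rows of g. *)
Lemma memG_eqns g a b c d e f p q r : g \in G -> m g = mx3 a b c d e f p q r ->
  [/\ a * (e * r - f * q) - b * (d * r - f * p) + c * (d * q - e * p) = 1,
      [/\ a * c^* + b * b^* + c * a^* = 0, a * f^* + b * e^* + c * d^* = 0
        & a * r^* + b * q^* + c * p^* = 1]
    & [/\ d * f^* + e * e^* + f * d^* = 1, d * r^* + e * q^* + f * p^* = 0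
        & p * r^* + q * q^* + r * p^* = 0]].
Proof.
case/memG=> det1 gJ def_g; rewrite def_g det_mx3 in det1.
move: gJ; rewrite def_g tr_mx3 map_mx3 !mul_mx3 => /mx3_inj.
rewrite !(mulr0, mulr1, addr0, add0r).
case=> [[[e1 e2 e3] [_ e5 e6]] [_ _ e9]]; split=> //; split.
- by rewrite -[RHS]e1; ring.
- by rewrite -[RHS]e2; ring.
- by rewrite -[RHS]e3; ring.
- by rewrite -[RHS]e5; ring.
- by rewrite -[RHS]e6; ring.
by rewrite -[RHS]e9; ring.
Qed.

(** The elements q(a, b), h(t) and w: unitriangular, diagonal and antidiagonal
    isometries.  The first one is an isometry when b + b^* + a a^* = 0. *)
Definition uq a b := mkgl m (mx3 1 a b 0 1 (- a^*) 0 0 1).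
Definition ut t := mkgl m (mx3 t 0 0 0 (t^* / t) 0 0 0 (t^*)^-1).
Definition uw := mkgl m (mx3 0 0 1 0 (-1) 0 1 0 0).

Arguments uq (a b)%_R.
Arguments ut t%_R.

Lemma uqE a b : m (uq a b) = mx3 1 a b 0 1 (- a^*) 0 0 1.
Proof. by rewrite mkgl1K // det_mx3; ring. Qed.

Lemma uwE : m uw = mx3 0 0 1 0 (-1) 0 1 0 0.
Proof. by rewrite mkgl1K // det_mx3; ring. Qed.

Let nzC a : a != 0 -> a^* != 0. Proof. by rewrite fmorph_eq0. Qed.

Lemma utE t : t != 0 -> m (ut t) = mx3 t 0 0 0 (t^* / t) 0 0 0 (t^*)^-1.
Proof.
by move=> nzt; rewrite mkgl1K // det_mx3; field; rewrite nzt nzC.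
Qed.

Lemma uqM a b c d : (uq a b * uq c d = uq (a + c) (b + d - a * c^*))%g.
Proof.
by apply: eqm; rewrite glmxM !uqE mul_mx3; congr mx3; rewrite ?rmorphD; ring.
Qed.

Lemma mem_uq a b : b + b^* + a * a^* = 0 -> uq a b \in G.
Proof.
move=> ab; apply/memG; rewrite uqE det_mx3 tr_mx3 map_mx3 !mul_mx3.
split; first by ring.
rewrite !rmorphE thetaK; congr mx3; try ring.
by rewrite -[RHS]ab; ring.
Qed.

Lemma mem_uw : uw \in G.
Proof.
apply/memG; rewrite uwE det_mx3 tr_mx3 map_mx3 !mul_mx3.
by rewrite !rmorphE; split; [ring | congr mx3; ring].
Qed.

Lemma mem_ut t : t != 0 -> ut t \in G.
Proof.
move=> nzt; apply/memG; rewrite utE // det_mx3 tr_mx3 map_mx3 !mul_mx3.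
split; first by field; rewrite nzt nzC.
by rewrite !rmorphE !fmorph_div !fmorphV !thetaK; congr mx3; field; rewrite ?nzt ?nzC.
Qed.

(** The stabilizer of the isotropic point spanned by the third basis vector. *)
Definition borel3 : {set gT} := [set g in G | (m g ord_max ord0 == 0)
  && (m g ord_max (Ordinal (isT : 1 < 3)%N) == 0)].

(** Orthogonality of the rows of a matrix with third row (0, 0, r) determines
    all entries from the first row. *)
Lemma borel3P g : reflect
    (exists t a b, [/\ t != 0, b + b^* + a * a^* = 0 & g = (ut t * uq a b)%g])
    (g \in borel3).
Proof.
apply: (iffP idP) => [| [t [u [v [nzt uv ->]]]]]; last first.
  by rewrite inE groupM ?mem_ut ?mem_uq //= glmxM utE // uqE mul_mx3 !mxE /=; apply/andP; split; apply/eqP; ring.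
have [a [b [c [d [e [f [p [q [r def_g]]]]]]]]] := mx3_eta (m g).
rewrite inE def_g !mxE /= => /and3P[Gg /eqP p0 /eqP q0]; rewrite p0 q0 in def_g.
have [det1 [e1 e2 e3] [e4 e5 e6]] := memG_eqns Gg def_g.
have {}e3 : a * r^* = 1 by rewrite -[RHS]e3 rmorph0; ring.
have nza : a != 0 by apply: contra_eqN e3 => /eqP->; rewrite mul0r eq_sym oner_eq0.
have nzr : r != 0 by apply: contra_eqN e3 => /eqP->; rewrite rmorph0 mulr0 eq_sym oner_eq0.
have def_r : r = a^*^-1.
  by apply: (can_inj thetaK); rewrite fmorphV thetaK -[LHS](mulKf nza) e3 mulr1.
have d0 : d = 0.
  apply: (mulIf (nzC nzr)); rewrite mul0r -[RHS]e5 !rmorph0; ring.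
rewrite d0 in def_g det1 e2 e4.
have def_e : e = a^* / a.
  have nzra : a * r != 0 by rewrite mulf_neq0.
  by apply: (mulfI nzra); transitivity (1 : F); [rewrite -[RHS]det1; ring | rewrite def_r; field; rewrite nza nzC].
exists a, (b / a), (c / a); split=> //.
  rewrite !fmorph_div; transitivity ((a * c^* + b * b^* + c * a^*) / (a * a^*)).
    by field; rewrite nza nzC.
  by rewrite e1 mul0r.
apply: eqm; rewrite glmxM utE // uqE mul_mx3 def_g def_e def_r.
congr mx3; rewrite ?fmorph_div ?rmorphE; try by field; rewrite ?nza ?nzC.
rewrite rmorph0 mulr0 addr0 in e2.
have {}e2 : f = - (b^* * e) / a^*.
  apply: (can_inj thetaK); apply: (mulfI nza); move/eqP: e2; rewrite addr_eq0 => /eqP->.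
  by rewrite fmorph_div !rmorphE rmorphM !thetaK; field.
by rewrite e2 def_e; field; rewrite nza nzC.
Qed.

Fact borel3_group_set : group_set borel3.
Proof.
apply/group_setP; split.
  by rewrite inE group1 glmx1 !mxE /= eqxx.
move=> g h /setIdP[Gg Bg] /setIdP[Gh Bh]; rewrite inE groupM // glmxM.
have [a [b [c [d [e [f [p [q [r def_g]]]]]]]]] := mx3_eta (m g).
have [a' [b' [c' [d' [e' [f' [p' [q' [r' def_h]]]]]]]]] := mx3_eta (m h).
move: Bg Bh; rewrite def_g def_h mul_mx3 !mxE /= => /andP[/eqP-> /eqP->] /andP[/eqP-> /eqP->].
by rewrite !mul0r !mulr0 !addr0 eqxx.
Qed.
Canonical borel3_group := Group borel3_group_set.

(** Let (p, q, r) be the last row of g.  If p = 0 then isotropy gives q = 0.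
    Otherwise the row is p times the last row of w q(q / p, r / p), so that g
    differs from the latter by an element fixing the third basis vector up to a
    scalar. *)
Lemma bruhat3 : G \subset borel3 :|: (borel3 * (uw *: borel3))%g.
Proof.
apply/subsetP=> g Gg; rewrite inE; have [//|nBg /=] := boolP (g \in borel3).
have [a [b [c [d [e [f [p [q [r def_g]]]]]]]]] := mx3_eta (m g).
have [_ _ [_ _ e6]] := memG_eqns Gg def_g.
have nzp : p != 0.
  apply: contraNneq nBg => p0; rewrite inE Gg def_g !mxE /= p0 eqxx /=.
  have : q * q^* = 0 by rewrite -[RHS]e6 p0 rmorph0; ring.
  by move/eqP; rewrite mulf_eq0 fmorph_eq0 orbb.
have qr : r / p + (r / p)^* + q / p * (q / p)^* = 0.
  rewrite !fmorph_div; transitivity ((p * r^* + q * q^* + r * p^*) / (p * p^*)).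
    by field; rewrite nzp nzC.
  by rewrite e6 mul0r.
pose h := (uw * uq (q / p) (r / p))%g; have Gh : h \in G by rewrite groupM ?mem_uw ?mem_uq.
have -> : g = (g * h^-1 * h)%g by rewrite mulgKV.
rewrite mem_mulg //; last first.
  rewrite mem_lcoset mulKg; apply/borel3P; exists 1, (q / p), (r / p); split; rewrite ?oner_neq0 //.
  apply: eqm; rewrite glmxM (utE (oner_neq0 F)) !uqE mul_mx3 rmorph1 divr1 invr1.
  by congr mx3; ring.
set y := (g * h^-1)%g; have Gy : y \in G by rewrite groupM ?groupV.
have [a' [b' [c' [d' [e' [f' [p' [q' [r' def_y]]]]]]]]] := mx3_eta (m y).
have : m (y * h)%g = m g by rewrite /y mulgKV.
rewrite glmxM def_g def_y /h glmxM uwE uqE !mul_mx3 => /mx3_inj[_ [ep eq er]].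
have def_r' : r' = p by rewrite -ep; ring.
have def_q' : q' = 0.
  by apply/eqP; rewrite -oppr_eq0 -(subrr q) -{1}eq def_r'; apply/eqP; field.
rewrite inE Gy def_y !mxE /= def_q' eqxx andbT; apply/eqP.
by rewrite -[RHS](subrr r) -{1}er def_r' def_q'; field; rewrite nzC.
Qed.

(** The chain B > Q > Z > 1, with Q the unitriangular elements and Z those with
    a = 0, has abelian quotients. *)
Lemma borel3_sol : solvable borel3_group.
Proof.
pose o1 : 'I_3 := Ordinal (isT : 1 < 3)%N.
have mB t a b : t != 0 -> m (ut t * uq a b)%g = mx3 t (t * a) (t * b)
    0 (t^* / t) (- (t^* / t * a^*)) 0 0 t^*^-1.
  move=> nzt; rewrite glmxM utE // uqE mul_mx3; congr mx3; ring.
(* Q is the unitriangular subgroup and Z its centre *)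
pose Q := [set g in borel3 | m g ord0 ord0 == 1].
have QP g : g \in Q -> exists a b, b + b^* + a * a^* = 0 /\ g = uq a b.
  case/setIdP=> /borel3P[t [a [b [nzt ab ->]]]]; rewrite mB // mxE /= => /eqP t1.
  exists a, b; split=> //; apply: eqm; rewrite mB // uqE t1 rmorph1 divr1 invr1.
  by congr mx3; ring.
have gQ : group_set Q.
  apply/group_setP; split=> [|g h Qg Qh].
    by rewrite inE group1 glmx1 !mxE /= eqxx.
  rewrite inE groupM; try by [move: Qg; case/setIdP | move: Qh; case/setIdP].
  have [a [b [_ ->]]] := QP _ Qg; have [c [d [_ ->]]] := QP _ Qh.
  by rewrite uqM uqE mxE /= eqxx.
pose Z := [set g in Q | m g ord0 o1 == 0].
have ZP g : g \in Z -> exists b, g = uq 0 b.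
  case/setIdP=> /QP[a [b [_ ->]]]; rewrite uqE mxE /= => /eqP->.
  by exists b.
have gZ : group_set Z.
  apply/group_setP; split=> [|g h Zg Zh].
    by rewrite inE (group1 (Group gQ)) glmx1 !mxE /= eqxx.
  rewrite inE (@groupM _ (Group gQ)); try by [move: Zg; case/setIdP | move: Zh; case/setIdP].
  have [b ->] := ZP _ Zg; have [d ->] := ZP _ Zh.
  by rewrite uqM addr0 uqE mxE /= eqxx.
have sB'Q : (borel3^`(1) \subset Group gQ)%g.
  rewrite gen_subG; apply/subsetP=> _ /imset2P[g h Bg Bh ->].
  have Bgh : [~ g, h]%g \in borel3 by rewrite groupR.
  rewrite inE Bgh /=; have /borel3P[t [a [b [nzt _ def_gh]]]] := Bgh.
  have := congr1 m (commgC g h); rewrite def_gh mB // mxE /=.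
  have /borel3P[t1 [a1 [b1 [nzt1 _ ->]]]] := Bg.
  have /borel3P[t2 [a2 [b2 [nzt2 _ ->]]]] := Bh.
  rewrite glmxM (glmxM _ (_ * _)) (glmxM _ (ut t2 * _)) !mB // !mul_mx3 => /mx3_inj[[[e _ _] _] _].
  have nzt12 : t1 * t2 != 0 by rewrite mulf_neq0.
  apply/eqP/(mulfI nzt12); rewrite mulr1.
  by move: e; rewrite !(mulr0, addr0) [t2 * t1]mulrC => <-.
have sQ'Z : ((Group gQ)^`(1) \subset Group gZ)%g.
  rewrite gen_subG; apply/subsetP=> _ /imset2P[g h Qg Qh ->].
  have Qgh : [~ g, h]%g \in Group gQ by rewrite groupR.
  rewrite inE Qgh /=; have [a [b [_ def_gh]]] := QP _ Qgh.
  have := commgC g h; rewrite def_gh uqE mxE /=.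
  have [a1 [b1 [_ ->]]] := QP _ Qg; have [a2 [b2 [_ ->]]] := QP _ Qh.
  move/(congr1 m); rewrite !uqM !uqE => /mx3_inj[[[_ e _] _] _].
  by move: e; rewrite [a2 + a1]addrC -[LHS]addr0 => /addrI <-.
apply/derivedP; exists 3; apply/trivgP.
have sder2 : (borel3^`(2) \subset Group gZ)%g by apply: subset_trans (dergS 1 sB'Q) sQ'Z.
apply: subset_trans (dergS 1 sder2) _; rewrite gen_subG.
apply/subsetP=> _ /imset2P[g h /ZP Zg /ZP Zh ->]; apply/set1gP/eqP/commgP.
have [b ->] := Zg; have [d ->] := Zh.
by rewrite /commute !uqM [b + d]addrC.
Qed.
(** Commutators with diag(-1, 1, -1) give, in characteristic 3, all q(a, N a)
    with N a = a a^*, and their products give all q(a, b).  Conjugation by w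
    gives the lower unitriangular elements, and together they generate w and the
    diagonal elements. *)
Lemma perfect3 : (G \subset G^`(1))%g.
Proof.
have uM1 : -1 != 0 :> F by rewrite oppr_eq0 oner_neq0.
have norm_uq a : a * a^* + (a * a^*)^* + a * a^* = 0.
  by rewrite rmorphM thetaK -[RHS](mulr0 (a * a^*)) -three0; ring.
have comp3 a : a + a + a = 0 by rewrite -[RHS](mulr0 a) -three0; ring.
have utN1 : m (ut (-1)) = mx3 (-1) 0 0 0 1 0 0 0 (-1).
  by rewrite utE // rmorphN rmorph1 divff // invrN1.
(* q(a, N a) is the commutator of diag(-1, 1, -1) with q(-a, N a) *)
have G'uqN a : uq a (a * a^*) \in (G^`(1))%g.
  have -> : uq a (a * a^*) = [~ ut (-1), uq (- a) (a * a^*)]%g.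
    symmetry; apply: commg_eq; apply: eqm; rewrite !glmxM !uqE utN1 !mul_mx3.
    rewrite rmorphN; congr mx3; try ring; apply/eqP; rewrite -subr_eq0.
      by rewrite -[X in _ == X](comp3 a); apply/eqP; ring.
    by rewrite -[X in _ == X](comp3 a^*); apply/eqP; ring.
  by rewrite mem_commg ?mem_ut // mem_uq // rmorphN mulrNN norm_uq.
(* up to its part in the centre of the unitriangular group, q(-s, N s) q(1, 1)
   is q(1 - s, N (1 - s)) *)
have G'uq0 s : s + s^* = 0 -> uq 0 s \in (G^`(1))%g.
  move=> s0; have sN : s^* = - s by apply/eqP; rewrite -addr_eq0 addrC s0.
  rewrite -(groupMl _ (G'uqN (1 - s))).
  have -> : (uq (1 - s) ((1 - s) * (1 - s)^*) * uq 0 s =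
             uq (- s) (- s * (- s)^*) * uq 1 (1 * theta 1%R))%g.
    by rewrite !uqM !(rmorphD, rmorphN, rmorph1, rmorph0) sN; congr uq; ring.
  by rewrite groupM ?G'uqN.
have G'uq a b : b + b^* + a * a^* = 0 -> uq a b \in (G^`(1))%g.
  move=> ab; have -> : uq a b = (uq a (a * a^*) * uq 0 (b - a * a^*))%g.
    by rewrite uqM rmorph0; congr uq; ring.
  rewrite groupM ?G'uqN // G'uq0 // rmorphB rmorphM thetaK.
  pose n := a * a^*; transitivity (b + b^* + n - (n + n + n)); first by rewrite /n; ring.
  by rewrite comp3 ab subrr.
pose ul c d := mkgl m (mx3 1 0 0 c^* 1 0 d (- c) 1).
have ulE c d : m (ul c d) = mx3 1 0 0 c^* 1 0 d (- c) 1.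
  by rewrite mkgl1K // det_mx3; ring.
have G'ul c d : d + d^* + c * c^* = 0 -> ul c d \in (G^`(1))%g.
  move=> cd; have <- : (uq c d ^ uw)%g = ul c d.
    by apply: conjg_eq; apply: eqm; rewrite !glmxM ulE uqE uwE !mul_mx3; congr mx3; ring.
  by rewrite memJ_norm ?G'uq // (subsetP (der_norm 1 G)) // mem_uw.
pose un b := mkgl m (mx3 0 0 b 0 (- (b^* / b)) 0 b^*^-1 0 0).
have unE b : b != 0 -> m (un b) = mx3 0 0 b 0 (- (b^* / b)) 0 b^*^-1 0 0.
  by move=> nzb; rewrite mkgl1K // det_mx3; field; rewrite nzb nzC.
(* the rank one relation writing an antidiagonal element as a product of three
   unitriangular ones, lower, upper and lower *)
have G'un b : b != 0 -> un b \in (G^`(1))%g.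
  move=> nzb; have [a ab] := norm_onto b.
  have def_q : uq a b = (ul (- (a / b^*))%R b^-1%R * un b * ul (- (a / b))%R b^-1%R)%g.
    apply: eqm; rewrite !glmxM !ulE unE // uqE !mul_mx3 !rmorphE !fmorph_div thetaK.
    congr mx3; try by [ring | field; rewrite nzb nzC].
      transitivity (1 - (b + b^* + a * a^*) / b); first by rewrite ab mul0r subr0.
      by field; rewrite nzb nzC.
    transitivity ((b + b^* + a * a^*) / (b * b^*)); first by rewrite ab mul0r.
    by field; rewrite nzb nzC.
  have cd1 : b^-1 + (b^-1)^* + - (a / b^*) * (- (a / b^*))^* = 0.
    rewrite rmorphN fmorphV fmorph_div thetaK mulrNN.
    transitivity ((b + b^* + a * a^*) / (b * b^*)); last by rewrite ab mul0r.
    by field; rewrite nzb nzC.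
  have cd2 : b^-1 + (b^-1)^* + - (a / b) * (- (a / b))^* = 0.
    rewrite rmorphN fmorphV fmorph_div mulrNN.
    transitivity ((b + b^* + a * a^*) / (b * b^*)); last by rewrite ab mul0r.
    by field; rewrite nzb nzC.
  have := G'uq _ _ ab; rewrite def_q groupMr ?G'ul // groupMl ?G'ul //.
have G'w : uw \in (G^`(1))%g.
  have <- : un 1 = uw by apply: eqm; rewrite unE ?oner_neq0 // uwE rmorph1 divr1 invr1.
  by rewrite G'un ?oner_neq0.
apply: (bruhat_gen bruhat3 _ G'w).
apply/subsetP=> _ /borel3P[t [a [b [nzt ab ->]]]]; rewrite groupM ?G'uq //.
have -> : ut t = (un t * uw)%g.
  by apply: eqm; rewrite glmxM unE // uwE utE // mul_mx3; congr mx3; ring.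
by rewrite groupM ?G'un.
Qed.

(** An element whose conjugates all lie in B fixes every isotropic point: the
    two coordinate points make it diagonal, and the same holds for its conjugate
    by q(1, 1), so it is scalar. *)
Lemma core3 g : (forall x, x \in G -> (g ^ x)%g \in borel3) -> g = 1%g.
Proof.
have core_diag h : (forall x, x \in G -> (h ^ x)%g \in borel3) ->
  exists2 t, t != 0 & h = ut t.
  move=> core; have /borel3P[t [a [b [nzt ab def_h]]]] : h \in borel3.
    by rewrite -(conjg1 h) core.
  have /borel3P[t' [a' [b' [nzt' _ def_hw]]]] := core _ mem_uw.
  have := congr1 m (conjgC h uw); rewrite def_hw def_h !glmxM !uqE uwE !utE // !mul_mx3.
  move/mx3_inj=> [[[]]].
  rewrite !(mulr0, mul0r, mulr1, mul1r, addr0, add0r) mulrN1 => tb ta _ _ _.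
  have a0 : a = 0 by apply: (mulfI nzt); rewrite mulr0; apply: oppr_inj; rewrite oppr0.
  have b0 : b = 0 by apply: (mulfI nzt); rewrite mulr0.
  exists t => //; rewrite a0 b0; apply: eqm; rewrite glmxM uqE utE // mul_mx3 rmorph0.
  by congr mx3; ring.
move=> core; have [t nzt def_g] := core_diag g core.
(* q1 moves the point fixed by the conjugate of B under w to a third point *)
pose q1 := uq 1 1; have Gq1 : q1 \in G.
  by rewrite mem_uq // rmorph1 -[RHS]three0; ring.
have [t' nzt' def_k] : exists2 t, t != 0 & (g ^ q1^-1)%g = ut t.
  by apply: core_diag => x Gx; rewrite -conjgM core // groupM ?groupV.
have : (q1 * g = ut t' * q1)%g by rewrite -def_k /conjg invgK mulgA mulgKV.
move/(congr1 m); rewrite def_g !glmxM !utE // uqE !mul_mx3 => /mx3_inj[[[]]].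
rewrite !(mulr0, mul0r, mulr1, mul1r, addr0, add0r) => <- e2 e3 _ _.
have tt : t^* = t * t by rewrite -[LHS](divfK nzt) e2.
have t3 : t * t * t = 1 by rewrite -tt -{2}e3 mulfV ?nzC.
(* in characteristic 3, t ^ 3 = 1 forces t = 1 *)
have t1 : t = 1.
  apply/eqP; rewrite -subr_eq0; suff: (t - 1) ^+ 3 == 0 by rewrite expf_eq0.
  have -> : (t - 1) ^+ 3 = t * t * t - 1 + 3%:R * (t - t ^+ 2) by ring.
  by rewrite t3 three0 subrr mul0r addr0.
by apply: eqm; rewrite utE // t1 rmorph1 divr1 invr1 glmx1 scalar_mx3.
Qed.

Lemma simple3 : simple G.
Proof.
have ntG : (1%g : {set gT}) \proper G.
  rewrite properE sub1G; apply/subsetPn; exists uw; first exact: mem_uw.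
  apply/set1gP=> /(congr1 m); rewrite uwE glmx1 scalar_mx3.
  by case/mx3_inj=> [[[/eqP]]]; rewrite eq_sym oner_eq0.
rewrite (isog_simple (quotient1_isog G)).
apply: (bruhat_simple (B := borel3_group) (Z := 1%G) (w := uw)) => //.
- by apply/subsetP=> g /setIdP[].
- exact: mem_uw.
- exact: bruhat3.
- exact: borel3_sol.
- exact: perfect3.
- exact: normal1.
by move=> g /core3->; apply: group1.
Qed.

End Hyperbolic.

(** * Change to a hyperbolic basis *)

Section HyperbolicBasis.

Variables (F : finFieldType) (theta : {rmorphism F -> F}).
Variable f : {hermitian 'rV[F]_3 for false & theta}.
Hypotheses (cardF : #|F| = 9%N) (thetaE : forall a, theta a = a ^+ 3).
Hypothesis f_nondeg : nondegenerate f.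
Local Notation V := ('rV[F]_3).
Implicit Types (u v w z x y : V).

Let fC' u v : f u v = theta (f v u) := fC f u v.

(** If z1 and z2 are isotropic with f(z1, z2) = c not 0, then z1 + c z2 is
    anisotropic; the norm being onto, it can be scaled to length 1. *)
Lemma ex_unit_vector u : u != 0 -> exists2 z, f z u = 0 & f z z = 1.
Proof.
move=> nzu; have [z1 [z2 [f1 f2 f12 _]]] := perp_nonorthogonal cardF thetaE f_nondeg nzu.
suff [z fzu nfz] : exists2 z, f z u = 0 & f z z != 0.
  have [a a4] := F9_norm_onto cardF (fself_cube f thetaE z).
  exists (a *: z); first by rewrite fZl fzu mulr0.
  rewrite fZl fZr mulrA thetaN4 // a4 -expr2.
  by case: (F9_cube_fixed (fself_cube f thetaE z)) nfz => ->; rewrite ?eqxx // ?sqrrN expr1n.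
have [f11 | ] := eqVneq (f z1 z1) 0; last by exists z1.
have [f22 | ] := eqVneq (f z2 z2) 0; last by exists z2.
exists (z1 + f z1 z2 *: z2); first by rewrite fDl fZl f1 f2 mulr0 addr0.
rewrite !(fDl, fDr, fZl, fZr) f11 f22 -(fC' z2) add0r mulr0 mulr0 addr0.
have -> : f z2 z1 * f z1 z2 + f z1 z2 * f z2 z1 = 2%:R * (f z1 z2 * f z2 z1) by ring.
by rewrite !mulf_neq0 ?F9_2nz // f_eq0C.
Qed.

(** In an orthogonal pair z1, z2 with f(z1, z1) = 1, the vector z1 + a z2 is
    isotropic if a has norm - f(z2, z2); this uses that f(z2, z2) is 1 or -1,
    hence its own inverse. *)
Lemma ex_isotropic u : u != 0 ->
  exists z, [/\ z != 0, f z u = 0 & f z z = 0].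
Proof.
move=> nzu; have [z1 f1 f11] := ex_unit_vector nzu.
have [z fzu nz] := perp_not_line f_nondeg z1 nzu.
pose z2 := z - f z z1 *: z1.
have f21 : f z2 z1 = 0 by rewrite /z2 -scaleNr fDl fZl f11 mulr1 subrr.
have f2 : f z2 u = 0 by rewrite /z2 -scaleNr fDl fZl f1 fzu mulr0 addr0.
have f12 : f z1 z2 = 0 by apply/eqP; rewrite f_eq0C f21.
have nz2 : z2 != 0 by rewrite subr_eq0 nz.
clearbody z2.
have [f22 | nf22] := eqVneq (f z2 z2) 0; first by exists z2.
have [a a4] : exists a, a ^+ 4 = - f z2 z2.
  by apply: F9_norm_onto => //; rewrite exprNn fself_cube // -signr_odd expr1 mulN1r.
exists (z1 + a *: z2); split.
- apply/eqP=> /(congr1 (f^~ z1)); rewrite fDl fZl f21 f11 mulr0 addr0 f0l.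
  by move/eqP; rewrite oner_eq0.
- by rewrite fDl fZl f1 f2 mulr0 addr0.
rewrite !(fDl, fDr, fZl, fZr) f11 f12 f21 !mulr0 addr0 add0r mulrA thetaN4 // a4.
by case: (F9_cube_fixed (fself_cube f thetaE z2)) nf22 => ->; rewrite ?eqxx // => _; ring.
Qed.

(** The middle vector is a unit vector e2, the two others an isotropic pair e1, e3
    in its orthogonal with f(e1, e3) = 1. *)
Lemma hyperbolic_basis : exists P : 'M[F]_3,
  P *m gram f *m map_mx theta P^T = hyperbolic F.
Proof.
have nz0 : delta_mx 0 0 != 0 :> V.
  by apply/eqP=> /matrixP/(_ 0 0)/eqP; rewrite !mxE oner_eq0.
have [e2 _ f22] := ex_unit_vector nz0.
have nze2 : e2 != 0 by apply: contra_eqN f22 => /eqP->; rewrite f0l eq_sym oner_eq0.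
have [e1 [nze1 f12 f11]] := ex_isotropic nze2.
have [z fz2 nfz1] : exists2 z, f z e2 = 0 & f z e1 != 0.
  suff /existsP[z /andP[/eqP fz2 nfz1]] : [exists z, (f z e2 == 0) && (f z e1 != 0)] by exists z.
  apply: contraT => /existsPn all0; have [a def_e1] : exists a, e1 = a *: e2.
    apply: (perp_colinear cardF thetaE f_nondeg nze2) => z fz2; apply/eqP.
    by have := all0 z; rewrite fz2 eqxx negbK.
  move/eqP: f12; rewrite def_e1 fZl f22 mulr1 => /eqP a0.
  by rewrite def_e1 a0 scale0r eqxx in nze1.
(* y is the partner of e1, made isotropic by adding a multiple of e1: as
   1 + 1 = -1, the number f y y has trace - f y y *)
pose y := (f z e1)^-1 *: z.
have fy1 : f y e1 = 1 by rewrite fZl mulVf.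
have fy2 : f y e2 = 0 by rewrite fZl fz2 mulr0.
clearbody y.
have f1y : f e1 y = 1 by rewrite fC' fy1 rmorph1.
have fyy : theta (f y y) = f y y by rewrite -fC'.
pose e3 := y + f y y *: e1.
have f13 : f e1 e3 = 1 by rewrite fDr fZr f11 mulr0 addr0.
have f31 : f e3 e1 = 1 by rewrite fC' f13 rmorph1.
have f32 : f e3 e2 = 0 by rewrite fDl fZl fy2 f12 mulr0 addr0.
have f23 : f e2 e3 = 0 by apply/eqP; rewrite f_eq0C f32.
have f21 : f e2 e1 = 0 by apply/eqP; rewrite f_eq0C f12.
have f33 : f e3 e3 = 0.
  rewrite !(fDl, fDr, fZl, fZr) f11 fy1 f1y fyy !mulr0 addr0 !mulr1.
  by rewrite -[RHS](mul0r (f y y)) -(F9_3 cardF); ring.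
exists (\matrix_(i < 3) nth 0 [:: e1; e2; e3] i).
apply/matrixP=> i j; rewrite gram_rows !rowK.
by case: i j => [[|[|[|//]]] ?] [[|[|[|//]]] ?]; rewrite mxE.
Qed.

Lemma isometry_gramP A :
  isometry_mx f A <-> A *m gram f *m map_mx theta A^T = gram f.
Proof.
split=> [isoA | gA u v].
  by apply/matrixP=> i j; rewrite gram_rows !rowE isoA mxE.
have : (f (u *m A) (v *m A))%:M = (f u v)%:M :> 'M_1.
  by rewrite -!gramE -[in RHS]gA trmx_mul map_mxM !mulmxA.
by move/matrixP/(_ 0 0); rewrite !mxE.
Qed.

End HyperbolicBasis.

Section ConjModel.

Variables (n : nat) (F : finFieldType) (gT : finGroupType).
Variables (m : GL_model n F gT) (P : 'M[F]_n.-1.+1).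
Hypothesis uP : P \in unitmx.

Lemma conj_model : {m' : GL_model n F gT |
  forall g, m' g = P *m m g *m invmx P}.
Proof.
unshelve eexists (@GLModel n F gT (fun g => P *m m g *m invmx P)
  (fun A => mkgl m (invmx P *m A *m P)) _ _ _ _ _) => //.
- move=> g h /(congr1 (fun A => invmx P *m A *m P)).
  by rewrite !mulmxA !mulVmx // !mul1mx !mulmxKV // => /glmx_inj.
- by rewrite /= glmx1 mulmx1 mulmxV.
- by move=> g h; rewrite /= glmxM !mulmxA mulmxKV.
- by move=> g; rewrite /= !unitmx_mul uP glmx_unit unitmx_inv uP.
move=> A uA; rewrite /= mkglK ?unitmx_mul ?unitmx_inv ?uP ?uA //.
by rewrite !mulmxA mulmxV // mul1mx mulmxK.
Qed.

End ConjModel.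

Section PSU3.

Variables (F : finFieldType) (theta : {rmorphism F -> F}).
Variable f : {hermitian 'rV[F]_3 for false & theta}.
Hypotheses (cardF : #|F| = 9%N) (thetaE : forall a, theta a = a ^+ 3).
Hypothesis f_nondeg : nondegenerate f.
Variables (gT : finGroupType) (m : GL_model 3 F gT).

(** The matrices of the same elements in the hyperbolic basis. *)
Lemma SUm_hyperbolic : exists m' : GL_model 3 F gT, forall g,
  g \in SUm_group f m <-> \det (m' g) = 1 /\
    m' g *m hyperbolic F *m map_mx theta (m' g)^T = hyperbolic F.
Proof.
have [P gP] := hyperbolic_basis cardF thetaE f_nondeg.
have uP : P \in unitmx.
  have : hyperbolic F \in unitmx.
    by rewrite unitmxE det_mx3; apply/unitrP; exists (-1); split; ring.
  by rewrite -gP unitmxE !det_mulmx unitrM => /andP[]; rewrite unitrM unitmxE => /andP[].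
have [m' m'E] := conj_model m uP; exists m' => g.
have uPt : map_mx theta P^T \in unitmx by rewrite map_unitmx unitmx_tr.
have detE : \det (m' g) = \det (m g).
  by rewrite m'E !det_mulmx mulrAC -det_mulmx mulmxV // det1 mul1r.
have gramE' : m' g *m hyperbolic F *m map_mx theta (m' g)^T =
    P *m (m g *m gram f *m map_mx theta (m g)^T) *m map_mx theta P^T.
  rewrite m'E -gP !trmx_mul !map_mxM !mulmxA mulmxKV //.
  rewrite -(mulmxA _ (map_mx theta P^T)) -map_mxM -trmx_mul mulVmx // trmx1 map_mx1.
  by rewrite mulmx1.
rewrite detE gramE' -gP.
split=> [/SUmP[-> /isometry_gramP->] // | [det1 e]].
apply/SUmP; split=> //; apply/isometry_gramP.
by apply: (can_inj (mulKmx uP)); apply: (can_inj (mulmxK uPt)).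
Qed.

Lemma simple_SUm : simple (SUm f m).
Proof.
have [m' memG] := SUm_hyperbolic.
apply: (simple3 (thetaK cardF thetaE) (F9_3 cardF) _ memG) => b.
have [a a4] : exists a, a ^+ 4 = - (b + theta b).
  apply: F9_norm_onto => //; rewrite -thetaE rmorphN rmorphD.
  by rewrite (thetaK cardF thetaE) addrC.
by exists a; rewrite thetaN4 // a4 subrr.
Qed.

(** With i ^ 2 = -1, the diagonal element h(i) = diag(i, -1, i). *)
Lemma SUm_order4 : exists2 g, g \in SUm f m & (g ^+ 4 = 1 /\ g ^+ 2 <> 1)%g.
Proof.
have [m' memG] := SUm_hyperbolic.
have [w w4] := F9_prim cardF; pose i := w ^+ 2.
have i2 : i ^+ 2 = -1 by rewrite -exprM.
have nzi : i != 0 by apply: contra_eqN i2 => /eqP->; rewrite expr0n eq_sym oppr_eq0 oner_eq0.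
have thi : theta i = - i by rewrite thetaE exprS i2 mulrN1.
have utiE : m' (ut theta m' i) = mx3 i 0 0 0 (-1) 0 0 0 i.
  rewrite utE // thi mulNr divff //; congr mx3.
  by apply: (mulIf nzi); rewrite -expr2 i2 invrN mulNr mulVf.
exists (ut theta m' i); first exact: (mem_ut (thetaK cardF thetaE) memG nzi).
have g2E : m' (ut theta m' i ^+ 2)%g = mx3 (-1) 0 0 0 1 0 0 0 (-1).
  rewrite expgS expg1 glmxM utiE mul_mx3 -expr2 i2.
  by congr mx3; ring.
split.
  apply: (@glmx_inj _ _ _ m'); rewrite (expgM _ 2 2) (expgS _ 1) expg1 glmxM g2E mul_mx3.
  by rewrite glmx1 scalar_mx3; congr mx3; ring.
move/(congr1 m'); rewrite g2E glmx1 scalar_mx3 => /mx3_inj[[[e _ _] _] _].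
by move/eqP: e; rewrite eq_sym -subr_eq0 opprK -mulr2n (negPf (F9_2nz cardF)).
Qed.

End PSU3.

(** * PSU(3, 3) and PSL(2, 13) *)

(** The centre of SU(3, 3) is trivial. *)
Lemma PSU_isog_SUm (F : finFieldType) (theta : {rmorphism F -> F})
    (f : {hermitian 'rV[F]_3 for false & theta}) :
    #|F| = 9%N -> (forall a, theta a = a ^+ 3) ->
  (SUm f (GL_modelP 3 F) \isog PSU (n := 3) f)%g.
Proof.
move=> cardF thetaE.
have -> : PSU (n := 3) f =
    (SUm f (GL_modelP 3 F) / (SUm f (GL_modelP 3 F) :&: scalm (GL_modelP 3 F)))%g by [].
suff -> : SUm f (GL_modelP 3 F) :&: scalm (GL_modelP 3 F) = 1%g by apply: quotient1_isog.
apply/trivgP/subsetP=> g /setIP[Gg]; rewrite inE => /is_scalar_mxP[a def_g].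
by apply/set1gP; apply: (SUm_scalar cardF thetaE Gg def_g).
Qed.

Lemma nacent_PSL13 : #|nacent (PSL 2 'F_13)| = 92%N.
Proof.
have cardF : #|'F_13| = 13%N by rewrite card_Fp.
have two_nz : 2%:R != 0 :> 'F_13 by [].
(* 5 ^ 2 = 26 - 1 and 2 ^ 2 + 6 ^ 2 = 39 + 1 *)
have i2 : 5%:R ^+ 2 = -1 :> 'F_13 by apply/eqP.
have uv1 : 2%:R ^+ 2 + 6%:R ^+ 2 = 1 :> 'F_13 by apply/eqP.
have nz6 : 6%:R != 0 :> 'F_13 by [].
have := card_nacent_PSL2 _ two_nz i2 uv1 two_nz nz6; rewrite cardF => /(_ isT).
by case: #|_| => //= k; lia.
Qed.

Lemma two_nonsquare13 (t : 'F_13) : t ^+ 2 != 2%:R.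
Proof.
(* Fermat: t ^ 13 = t, whereas t ^ 12 = 2 ^ 6 = 65 - 1 *)
apply/eqP=> t2; have p6 : 2%:R ^+ 6 = -1 :> 'F_13 by apply/eqP.
have := expf_card t; rewrite card_Fp // exprS (exprM t 2 6) t2 p6 mulrN1.
move/eqP; rewrite eq_sym -subr_eq0 opprK -mulr2n -mulr_natl mulf_eq0 => /orP[//|/eqP t0].
by move: t2; rewrite t0 expr0n => /esym/eqP.
Qed.

Lemma PSL13_no_order4 x : x \in PSL 2 'F_13 -> (x ^+ 4 = 1 -> x ^+ 2 = 1)%g.
Proof. exact: PSL2_no_order4 two_nonsquare13. Qed.

Section StandardForm.

Variables (F : finFieldType) (theta : {rmorphism F -> F}).
Hypothesis thetaK : involutive theta.

(** The standard Hermitian form, a witness that the hypotheses on f can be met. *)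
Definition dot_form (u v : 'rV[F]_3) := \sum_i u 0 i * theta (v 0 i).

Lemma dot_form_bilinear : bilinear_for
  (GRing.Scale.Law.clone _ _ ( *%R ) _) (GRing.Scale.Law.clone _ _ (theta \; *%R ) _)
  dot_form.
Proof.
split=> [v a x y | u a x y] /=; rewrite /dot_form mulr_sumr -big_split /=;
  apply: eq_bigr => i _; rewrite !mxE.
  by rewrite mulrDl mulrA.
by rewrite rmorphD rmorphM mulrDr mulrCA.
Qed.
HB.instance Definition _ := bilinear_isBilinear.Build F
  'rV[F]_3 'rV[F]_3 F (GRing.Scale.Law.clone _ _ ( *%R ) _)
  (GRing.Scale.Law.clone _ _ (theta \; *%R ) _) dot_form dot_form_bilinear.
Lemma dot_form_hermitian x y : dot_form x y = (-1) ^+ false * theta (dot_form y x).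
Proof.
rewrite expr0 mul1r rmorph_sum; apply: eq_bigr => i _.
by rewrite rmorphM thetaK mulrC.
Qed.
HB.instance Definition _ := @isHermitianSesquilinear.Build F 'rV[F]_3 false theta dot_form dot_form_hermitian.

Lemma ex_nondegenerate :
  exists f : {hermitian 'rV[F]_3 for false & theta}, nondegenerate f.
Proof.
exists dot_form; rewrite /nondegenerate -subv0; apply/subvP=> u /mem_orthovP u0.
rewrite memv0; apply/eqP/rowP=> i; rewrite mxE.
have := u0 (delta_mx 0 i) (memvf _); rewrite /= /dot_form (bigD1 i) //= big1 => [|j nji].
  by rewrite mxE !eqxx rmorph1 mulr1 addr0.
by rewrite mxE (negPf nji) andbF rmorph0 mulr0.
Qed.

End StandardForm.

Local Close Scope ring_scope.
Local Open Scope group_scope.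

Lemma PSU3_facts (F : finFieldType) (theta : {rmorphism F -> F})
    (f : {hermitian 'rV[F]_3 for false & theta}%R) :
    #|F| = 9 -> (forall a : F, theta a = (a ^+ 3)%R) -> nondegenerate f ->
  [/\ simple (PSU (n := 3) f), #|nacent (PSU (n := 3) f)| = 92
    & ~ (PSU (n := 3) f \isog PSL 2 'F_13)].
Proof.
move=> cardF thetaE f_nondeg; have isoU := PSU_isog_SUm f cardF thetaE.
have simU := simple_SUm cardF thetaE f_nondeg (GL_modelP 3 F).
split.
- by rewrite -(isog_simple isoU).
- rewrite -(card_nacent_isog isoU).
  have := card_nacent_SUm cardF thetaE f_nondeg simU.
  by case: #|_| => //= k; lia.
move=> isoUL; have /isogP[phi injphi imphi] := isog_trans isoU isoUL.
have [g Gg [g4 g2]] := SUm_order4 cardF thetaE f_nondeg (GL_modelP 3 F).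
case: g2; apply: (injmP injphi); rewrite ?groupX // morph1 morphX //.
have phig := mem_morphim phi Gg Gg; rewrite imphi in phig.
apply: PSL13_no_order4 => //.
by rewrite -morphX // g4 morph1.
Qed.

Theorem mainTheorem1 :
  [/\ simple (PSL 2 'F_13),
      #|nacent (PSL 2 'F_13)| = 92,
      forall (F : finFieldType) (theta : {rmorphism F -> F})
             (f : {hermitian 'rV[F]_3 for false & theta}%R),
        #|F| = 9 -> (forall a : F, theta a = (a ^+ 3)%R) -> nondegenerate f ->
        [/\ simple (PSU (n := 3) f),
            #|nacent (PSU (n := 3) f)| = 92
          & ~ (PSU (n := 3) f \isog PSL 2 'F_13)],
      ~ (forall (gT rT : finGroupType) (G : {group gT}) (H : {group rT}),
           simple G -> simple H -> #|nacent G| = #|nacent H| -> G \isog H)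
    & ~ (forall (gT rT : finGroupType) (G : {group gT}) (H : {group rT}),
           simple G -> simple H -> #|nacent G| = #|nacent H| ->
           2 <= #|nacent G| -> G \isog H)].
Proof.
have simL : simple (PSL 2 'F_13) by apply: simple_PSL2; rewrite card_Fp.
have nacL := nacent_PSL13.
have [F char3 cardF] := pPrimePowerField (isT : prime 3) (isT : 0 < 2).
pose theta : {rmorphism F -> F} := pFrobenius_aut char3.
have thetaE (a : F) : theta a = (a ^+ 3)%R by [].
have [f f_nondeg] := ex_nondegenerate (thetaK cardF thetaE).
have [simU nacU nisoUL] := PSU3_facts cardF thetaE f_nondeg.
pose U := (SU_group (n := 3) f / (SU_group (n := 3) f :&: scalars_group 3 F))%G.
pose L := (SL_group 2 'F_13 / (SL_group 2 'F_13 :&: scalars_group 2 'F_13))%G.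
have eqUL : #|nacent U| = #|nacent L| := etrans nacU (esym nacL).
split=> //; first exact: PSU3_facts.
  by move=> allG; apply: nisoUL; apply: (allG _ _ U L simU simL eqUL).
move=> allG; apply: nisoUL; apply: (allG _ _ U L simU simL eqUL).
by rewrite [#|_|]nacU.
Qed.
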